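(* Let $(X_i)_{i\in\mathbb{Z}}$ and $(Y_i)_{i\in\mathbb{Z}}$ be two strictly stationary sequences of real-valued random variables, the two sequences being independent of each other, and let $(m_n)_{n\ge1}$ be a sequence of positive integers such that $\lim_{n\to\infty} n/m_n=c$ for some $c\in[0,\infty)$. Assume that $$\sum_{k=1}^\infty \alpha_{2,\mathbf{X}}(k)<\infty\quad\text{and}\quad \sum_{k=1}^\infty \alpha_{2,\mathbf{Y}}(k)<\infty .$$ With $m=m_n$, let $$H_m(t)=\frac1m\sum_{j=1}^m\mathbf{1}_{Y_j>t},\qquad G_n(t)=\frac1n\sum_{i=1}^n\mathbf{1}_{X_i<t},$$ $$\hat\gamma_X(k)=\frac1n\sum_{i=1}^{n-k}(H_m(X_i)-\bar H_m)(H_m(X_{i+k})-\bar H_m),\qquad \hat\gamma_Y(\ell)=\frac1m\sum_{j=1}^{m-\ell}(G_n(Y_j)-\bar G_n)(G_n(Y_{j+\ell})-\bar G_n),$$ where $n\bar H_m=\sum_{i=1}^n H_m(X_i)$ and $m\bar G_n=\sum_{j=1}^m G_n(Y_j)$. Let also $(a_n)$ and $(b_n)$ be two sequences of positive integers tending to infinity as $n\to\infty$, such that $a_n=o(\sqrt n)$ and $b_n=o(\sqrt{m_n})$. Then $$V_n=\hat\gamma_X(0)+2\sum_{k=1}^{a_n}\hat\gamma_X(k)+\frac{n}{m_n}\left(\hat\gamma_Y(0)+2\sum_{\ell=1}^{b_n}\hat\gamma_Y(\ell)\right)$$ converges in $\mathbb{L}^2$, as $n\to\infty$, to $$V=\mathrm{Var}(H_Y(X_0))+2\sum_{k=1}^\infty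 \mathrm{Cov}(H_Y(X_0),H_Y(X_k))+c\left(\mathrm{Var}(G_X(Y_0))+2\sum_{k=1}^\infty \mathrm{Cov}(G_X(Y_0),G_X(Y_k))\right).$$
   Context: Notation. $H_Y(t)=\mathbb{P}(Y_1>t)$ and $G_X(t)=\mathbb{P}(X_1<t)$ for $t\in\mathbb{R}$. Empty sums are zero. Dependence coefficients. For a strictly stationary sequence $(X_i)_{i\in\mathbb{Z}}$ of real-valued random variables, let $\mathcal{F}_0=\sigma(X_k,k\le0)$, let $F$ be the cumulative distribution function of $X_0$, and let $f_x(z)=\mathbf{1}_{z\le x}-F(x)$. For any non-negative integer $n$, $$\alpha_{1,\mathbf{X}}(n)=\sup_{x\in\mathbb{R}}\left\|\mathbb{E}(\mathbf{1}_{X_n\le x}\mid\mathcal{F}_0)-F(x)\right\|_1,$$ $$\alpha_{2,\mathbf{X}}(n)=\max\left\{\alpha_{1,\mathbf{X}}(n),\ \sup_{x,y\in\mathbb{R},\,j\ge i\ge n}\left\|\mathbb{E}(f_x(X_i)f_y(X_j)\mid\mathcal{F}_0)-\mathbb{E}(f_x(X_i)f_y(X_j))\right\|_1\right\},$$ where $\|\cdot\|_1$ is the $\mathbb{L}^1$ norm; $\alpha_{2,\mathbf{Y}}$ is defined in the same way from $(Y_i)_{i\in\mathbb{Z}}$. *)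

(* Defs.v *)
From HB Require Import structures.
From mathcomp Require Import all_boot all_order all_algebra.
From mathcomp Require Import all_classical all_reals all_analysis.

Set Implicit Arguments.
Unset Strict Implicit.
Unset Printing Implicit Defensive.

Import Order.TTheory GRing.Theory Num.Theory.
Import numFieldNormedType.Exports.

Local Open Scope classical_set_scope.
Local Open Scope ring_scope.

Section conditional_expectation.
Context d (T : measurableType d) (R : realType) (P : probability T R).

(* [g] is a version of E(f | F), for a sub-sigma-algebra F of the events *)
Definition is_cond_exp (F : set (set T)) (f g : T -> R) : Prop :=
  [/\ P.-integrable setT (EFin \o g),
      (forall B : set R, measurable B -> F (g @^-1` B)) &
      (forall A, F A ->
        (\int[P]_(w in A) (g w)%:E = \int[P]_(w in A) (f w)%:E)%E)].

(* A chosen version of E(f | F). One exists for every integrable f by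
   Radon-Nikodym, and two versions agree almost surely, so neither the choice
   nor the default value 0 affects the norms taken below. *)
Definition cond_exp (F : set (set T)) (f : T -> R) : T -> R :=
  xget (fun=> 0) (is_cond_exp F f).

End conditional_expectation.

Section processes.
Context d (T : measurableType d) (R : realType) (P : probability T R).
Implicit Types X Y : int -> {RV P >-> R}.

(* sigma(X_i, i in I) *)
Definition sigma_process X (I : set int) : set (set T) :=
  <<s \bigcup_(i in I) preimage_set_system setT (X i) measurable >>.

(* Every finite-dimensional distribution is invariant under every shift of the
   indices; R^k carries the product sigma-algebra. *)
Definition strictly_stationary X : Prop :=
  forall (k : nat) (t : k.-tuple int) (h : int) (B : set (k.-tuple R)),
    measurable B ->
    P [set w | B [tuple X (tnth t l + h) w | l < k]] =
    P [set w | B [tuple X (tnth t l) w | l < k]].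

Definition independent_processes X Y : Prop :=
  forall A B : set T, sigma_process X setT A -> sigma_process Y setT B ->
    P (A `&` B) = (P A * P B)%E.

Definition past X : set (set T) := sigma_process X [set k : int | k <= 0].

Definition F_of X (x : R) : R := fine (cdf (X 0) x).

Definition centered_ind X (x z : R) : R := (z <= x)%R%:R - F_of X x.

(* || E(f | F_0) - e ||_1 *)
Definition L1_dev X (f : T -> R) (e : R) : \bar R :=
  'N[P]_1[EFin \o (cond_exp P (past X) f \- cst e)%R]%E.

Definition alpha1 X (n : nat) : \bar R :=
  ereal_sup [set L1_dev X (fun w => (X n w <= x)%R%:R) (F_of X x)
            | x in [set: R]].

Definition alpha2_joint X (n : nat) : \bar R :=
  ereal_sup [set e | exists (x y : R) (i j : nat),
    let f w := centered_ind X x (X i w) * centered_ind X y (X j w) in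
    [/\ (n <= i)%N, (i <= j)%N & e = L1_dev X f (fine 'E_P[f]%E)]].

Definition alpha2 X (n : nat) : \bar R :=
  Order.max (alpha1 X n) (alpha2_joint X n).

(* H_Y and G_X *)
Definition H_of Y (t : R) : R := fine (ccdf (Y 1) t).

Definition G_of X (t : R) : R := fine (P [set w | X 1 w < t]).

Definition H_emp Y (m : nat) (w : T) (t : R) : R :=
  (m%:R)^-1 * \sum_(1 <= j < m.+1) (t < Y j w)%R%:R.

Definition G_emp X (n : nat) (w : T) (t : R) : R :=
  (n%:R)^-1 * \sum_(1 <= i < n.+1) (X i w < t)%R%:R.

Definition cov_lag (Z : int -> T -> R) (k : nat) : R :=
  fine (covariance P (Z 0) (Z k)).

(* Meaningful when the series of covariances converges. *)
Definition long_run_var (Z : int -> T -> R) : R :=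
  fine 'V_P[Z 0%R]%E + 2 * \big[+%R/0]_(1 <= k <oo) cov_lag Z k.

End processes.

Section empirical_autocovariance.
Context (R : realType).

(* u_1, ..., u_N are the observations; u_0 is not used *)
Definition emp_mean (N : nat) (u : nat -> R) : R :=
  (N%:R)^-1 * \sum_(1 <= i < N.+1) u i.

(* [N - k] is truncated, so the sum is empty for N <= k *)
Definition emp_autocov (N : nat) (u : nat -> R) (k : nat) : R :=
  (N%:R)^-1 * \sum_(1 <= i < (N - k).+1)
     (u i - emp_mean N u) * (u (i + k)%N - emp_mean N u).

Definition emp_long_run_var (N : nat) (u : nat -> R) (a : nat) : R :=
  emp_autocov N u 0 + 2 * \sum_(1 <= k < a.+1) emp_autocov N u k.

End empirical_autocovariance.

Section variance_estimator.
Context d (T : measurableType d) (R : realType) (P : probability T R).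
Implicit Types X Y : int -> {RV P >-> R}.

Definition V_est X Y (n m a b : nat) (w : T) : R :=
  emp_long_run_var n (fun i => H_emp Y m w (X i w)) a +
  n%:R / m%:R * emp_long_run_var m (fun j => G_emp X n w (Y j w)) b.

Definition V_lim X Y (c : R) : R :=
  long_run_var P (fun i => H_of Y \o X i) +
  c * long_run_var P (fun i => G_of X \o Y i).

End variance_estimator.

(* Main.v *)
Require Import Defs.
From HB Require Import structures.
From mathcomp Require Import all_boot all_order all_algebra.
From mathcomp Require Import all_classical all_reals all_analysis.
From mathcomp Require Import measurable_realfun zify ring lra.

Set Implicit Arguments.
Unset Strict Implicit.
Unset Printing Implicit Defensive.

Import Order.TTheory GRing.Theory Num.Theory.
Import numFieldNormedType.Exports.

Local Open Scope classical_set_scope.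
Local Open Scope ring_scope.

(** Write W_i = h(X_i) - E h(X_i) with h monotone and [0,1]-valued. Such an h is
    a limit of averages of indicators of half-lines, so the coefficients alpha_2,
    which only test half-lines, control E(W_i W_j), E(W_i W_j W_k W_l) for the last
    gap, and Cov(W_i W_j, W_k W_l) for the middle gap. Summability of alpha_2 then
    gives E(mean W)^2 = O(1/n), and the truncated sum of empirical covariances of W
    has variance O(a^2/n) and bias o(1). The same O(1/m) bound, applied to the
    indicators defining H_m and integrated against the law of X_i by independence,
    shows that replacing H_m by H_Y and the empirical mean by the true mean costs
    O(a^2/m + a^2/n) in mean square. The Y part is the same statement with the
    roles exchanged, multiplied by n/m. *)

(** * Expectation of bounded measurable functions *)

(** Two difficulties shape the argument. The coefficients are [L^1] norms given the past of time 0,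
    and each tests one choice of half-lines. Every use on a product of centred values therefore
    needs a stationary shift that puts the last of the early indices at 0, and then a monotone
    reduction of each late factor in turn. The early factors are reduced to events of the past by
    the same monotone device, which costs the factor 2 seen in all covariance bounds. The other
    difficulty is the second sample size. Replacing [G_X] by [G_n] costs [b^2/n] in mean square, and
    [b = o(sqrt m)] does not make this small when [m] is much larger than [n]. It is the prefactor
    that saves the estimate: [(n/m)^2 * b^2/n = (n/m) * b^2/m]. Hence the one-sided convergence
    result carries the multiplier inside and cannot be split into a convergent estimator times a
    bounded factor. *)

Section bounded_measurable.
Context d (T : measurableType d) (R : realType).
Implicit Types f g : T -> R.

(** Every variable in the proof is bounded. Unlike integrability, this class is stable under
    products, so integrability side conditions follow from the shape of the expression. *)
Definition bmeas f :=
  measurable_fun setT f /\ exists M : R, forall x, `|f x| <= M.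

Lemma bmeas_cst (c : R) : bmeas (fun=> c).
Proof. by split; [exact: measurable_cst | exists `|c|]. Qed.

Lemma bmeasD f g : bmeas f -> bmeas g -> bmeas (fun x => f x + g x).
Proof.
move=> [mf [M fM]] [mg [N gN]]; split; first exact: measurable_funD.
by exists (M + N) => x; rewrite (le_trans (ler_normD _ _))// lerD.
Qed.

Lemma bmeasM f g : bmeas f -> bmeas g -> bmeas (fun x => f x * g x).
Proof.
move=> [mf [M fM]] [mg [N gN]]; split; first exact: measurable_funM.
by exists (M * N) => x; rewrite normrM ler_pM.
Qed.

Lemma bmeasN f : bmeas f -> bmeas (fun x => - f x).
Proof.
move=> [mf [M fM]]; split; first exact: measurableT_comp.
by exists M => x; rewrite normrN.
Qed.

Lemma bmeasB f g : bmeas f -> bmeas g -> bmeas (fun x => f x - g x).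
Proof. by move=> bf bg; exact: bmeasD bf (bmeasN bg). Qed.

Lemma bmeasX f n : bmeas f -> bmeas (fun x => f x ^+ n).
Proof.
move=> [mf [M fM]]; split; first exact: measurable_funX.
by exists (M ^+ n) => x;
  rewrite normrX lerXn2r// nnegrE (le_trans _ (fM point)).
Qed.

Lemma bmeas_norm f : bmeas f -> bmeas (fun x => `|f x|).
Proof.
move=> [mf [M fM]]; split; first exact: measurableT_comp.
by exists M => x; rewrite normr_id.
Qed.

Lemma bmeas_sum (I : Type) (s : seq I) (p : pred I) (F : I -> T -> R) :
  (forall i, bmeas (F i)) -> bmeas (fun x => \sum_(i <- s | p i) F i x).
Proof.
move=> bF; elim: s => [|i s IHs].
  by under eq_fun do rewrite big_nil; exact: bmeas_cst.
under eq_fun do rewrite big_cons; case: (p i) => //; exact: bmeasD.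
Qed.

Lemma bmeas_prod (I : Type) (s : seq I) (p : pred I) (F : I -> T -> R) :
  (forall i, bmeas (F i)) -> bmeas (fun x => \prod_(i <- s | p i) F i x).
Proof.
move=> bF; elim: s => [|i s IHs].
  by under eq_fun do rewrite big_nil; exact: bmeas_cst.
under eq_fun do rewrite big_cons; case: (p i) => //; exact: bmeasM.
Qed.

Lemma bmeas_le1 f : measurable_fun setT f -> (forall x, `|f x| <= 1) -> bmeas f.
Proof. by move=> mf f1; split => //; exists 1. Qed.

End bounded_measurable.

Lemma bmeas_comp d d' (T : measurableType d) (T' : measurableType d')
  (R : realType)
  (f : T -> T') (g : T' -> R) :
  measurable_fun setT f -> bmeas g -> bmeas (g \o f).
Proof.
by move=> mf [mg [M gM]]; split;
  [exact: measurableT_comp|exists M => x; exact: gM].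
Qed.

Section expectation.
Context d (T : measurableType d) (R : realType) (P : probability T R).
Implicit Types f g : T -> R.
Local Notation E f := (Rintegral P setT f).

Lemma bmeas_integrable D f : measurable D -> bmeas f ->
  P.-integrable D (EFin \o f).
Proof.
move=> mD [mf [M fM]].
apply: measurable_bounded_integrable => //.
- by rewrite (le_lt_trans (probability_le1 P mD))// ltry.
- exact: measurable_funTS.
- exists M; rewrite num_real; split=> // N MN x _;
  exact: le_trans (fM x) (ltW MN).
Qed.

Lemma expD f g : bmeas f -> bmeas g -> E (fun x => f x + g x) = E f + E g.
Proof. by move=> bf bg; rewrite RintegralD//; exact: bmeas_integrable. Qed.

Lemma expB f g : bmeas f -> bmeas g -> E (fun x => f x - g x) = E f - E g.
Proof. by move=> bf bg; rewrite RintegralB//; exact: bmeas_integrable. Qed.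

Lemma expZl r f : bmeas f -> E (fun x => r * f x) = r * E f.
Proof. by move=> bf; rewrite RintegralZl//; exact: bmeas_integrable. Qed.

Lemma expZr r f : bmeas f -> E (fun x => f x * r) = E f * r.
Proof. by move=> bf; rewrite RintegralZr//; exact: bmeas_integrable. Qed.

Lemma exp_cst r : E (fun=> r) = r.
Proof.
have := Rintegral_cst P measurableT r.
rewrite (_ : fine _ = 1) ?mulr1//.
by rewrite -[RHS]/(fine 1%E); congr fine; exact: probability_setT.
Qed.

Lemma eq_exp f g : f =1 g -> E f = E g.
Proof. by move=> fg; apply: eq_Rintegral => x _; exact: fg. Qed.

Lemma le_exp f g : bmeas f -> bmeas g -> (forall x, f x <= g x) -> E f <= E g.
Proof.
by move=> bf bg fg; apply: le_Rintegral => //; exact: bmeas_integrable.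
Qed.

Lemma exp_ge0 f : (forall x, 0 <= f x) -> 0 <= E f.
Proof. by move=> f0; exact: Rintegral_ge0. Qed.

Lemma norm_exp f : bmeas f -> `|E f| <= E (fun x => `|f x|).
Proof. by move=> bf; apply: le_normr_Rintegral => //;
  exact: bmeas_integrable. Qed.

Lemma norm_exp_le f M : bmeas f -> (forall x, `|f x| <= M) -> `|E f| <= M.
Proof.
move=> bf fM; apply: (le_trans (norm_exp bf)).
by rewrite -[leRHS]exp_cst; apply: le_exp => //;
  [exact: bmeas_norm|exact: bmeas_cst].
Qed.

Lemma exp_sum (I : Type) (s : seq I) (p : pred I) (F : I -> T -> R) :
  (forall i, bmeas (F i)) ->
  E (fun x => \sum_(i <- s | p i) F i x) = \sum_(i <- s | p i) E (F i).
Proof.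
move=> bF; elim: s => [|i s IHs].
  by rewrite big_nil -[RHS]exp_cst; apply: eq_exp => x; rewrite big_nil.
rewrite big_cons -IHs; case: ifPn => pi.
  by rewrite -expD//;
    [apply: eq_exp => x; rewrite big_cons pi|exact: bmeas_sum].
by apply: eq_exp => x; rewrite big_cons (negbTE pi).
Qed.

Lemma EFin_exp f : bmeas f -> (\int[P]_x (f x)%:E)%E = (E f)%:E.
Proof.
move=> bf; rewrite /Rintegral fineK//; apply: integrable_fin_num => //.
exact: bmeas_integrable.
Qed.

Lemma exp_indic (A : set T) : measurable A -> E (\1_A) = fine (P A).
Proof. by move=> mA; rewrite /Rintegral integral_indic// setIT. Qed.

Lemma exp_indicM (A : set T) f : measurable A ->
  E (fun x => \1_A x * f x) = \int[P]_(x in A) f x.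
Proof.
move=> mA; rewrite [RHS]Rintegral_mkcond; apply: eq_exp => x.
by rewrite indicE patchE; case: (x \in A); rewrite ?mul1r ?mul0r.
Qed.

Lemma exp_cvg (f_ : nat -> T -> R) f M : (forall n, bmeas (f_ n)) ->
  (forall n x, `|f_ n x| <= M) -> (forall x, f_ ^~ x @ \oo --> f x) ->
  E (f_ n) @[n --> \oo] --> E f.
Proof.
move=> bf fM ff.
have mf : measurable_fun setT f.
  apply: (measurable_fun_cvg (h := f_)) => //.
  by move=> n; exact: (bf n).1.
have mE g : measurable_fun setT g -> measurable_fun setT (EFin \o g).
  by move=> mg; exact/measurable_EFinP.
have ffE x : (f_ n x)%:E @[n --> \oo] --> (f x)%:E.
  by apply: cvg_EFin; [exact: nearW|exact: ff].
have [_ _] := @dominated_convergence _ _ _ P setT measurableT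
  (fun n x => (f_ n x)%:E) (fun x => (f x)%:E) (fun=> M%:E)
  (fun n => mE _ (bf n).1) (mE _ mf)
  (aeW _ (fun x _ => ffE x))
  (bmeas_integrable measurableT (bmeas_cst _ M))
  (aeW _ (fun x n _ => fM n x)).
have fM' x : `|f x| <= M.
  have : `|f_ n x| @[n --> \oo] --> `|f x| by apply: cvg_norm; exact: ff.
  move=> fx; rewrite -(cvg_lim _ fx)//; apply: limr_le.
    by apply/cvg_ex; exists `|f x|.
  by apply: nearW => n; exact: fM.
move=> h; apply: fine_cvg; rewrite fineK; last by rewrite EFin_exp//;
  split=> //; exists M.
exact: h.
Qed.

End expectation.

(** * Conditional expectations and monotone functionals *)

Section conditional_expectation.
Context d (T : measurableType d) (R : realType) (P : probability T R).
Variable G : set (set T).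
Hypothesis GT : G `<=` measurable.

Let sub_sigma : <<s G >> `<=` measurable.
Proof. by apply: smallest_sub => //; exact: sigma_algebra_measurable. Qed.

(** The codomain carries the coarser sigma-algebra, so the law of this identity map is the
    restriction of [P] to [<<s G>>], the measure on which Radon-Nikodym is applied. *)
Definition sub_sigma_id (x : T) : g_sigma_algebraType G := x.

Let measurable_sub_sigma_id : measurable_fun setT sub_sigma_id.
Proof. by move=> _ A mA; rewrite setTI; exact: sub_sigma. Qed.

HB.instance Definition _ := @isMeasurableFun.Build _ _ _ _ sub_sigma_id
  measurable_sub_sigma_id.

(** The version is the density of the charge [f dP] with respect to [P], both restricted to
    [<<s G>>]. Existence matters because [cond_exp] falls back on 0 when there is no version. *)
Lemma cond_exp_exists (f : T -> R) : bmeas f ->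
  exists g, is_cond_exp P <<s G >> f g.
Proof.
move=> bf.
have intf : P.-integrable setT (EFin \o f) by exact: bmeas_integrable.
pose id' : {mfun T >-> g_sigma_algebraType G} := sub_sigma_id.
pose P' := distribution P id'.
pose nu0 : {charge set (g_sigma_algebraType G) -> \bar R} :=
  pushforward (induced_charge intf) id'.
pose nu := nu0 (measurable_funPT id').
have nuP : nu `<< P'.
  apply/null_content_dominatesP => A mA; rewrite /P' /distribution/= => PA0.
  apply: null_set_integral => //; first exact: (sub_sigma mA).
  by apply: measurable_funTS; exact: measurable_int intf.
pose g := fine \o Radon_Nikodym nu P'.
have gE x : (g x)%:E = Radon_Nikodym nu P' x.
  by rewrite /g/= fineK//; exact: Radon_Nikodym_fin_num.
have mgE : measurable_fun setT (EFin \o g).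
  rewrite (_ : _ \o _ = Radon_Nikodym nu P'); last by apply/funext => x;
    exact: gE.
  exact: measurable_int (Radon_Nikodym_integrable nuP).
have mg : measurable_fun setT g by apply/measurable_EFinP.
have intg : P.-integrable setT (EFin \o (g \o id')).
  apply/integrableP; split; first by apply/measurable_EFinP;
    exact: measurableT_comp.
  have /integrableP[_] := Radon_Nikodym_integrable nuP.
  rewrite ge0_integral_distribution//; last by apply: measurableT_comp => //;
    exact: measurable_int (Radon_Nikodym_integrable nuP).
  by under eq_integral do rewrite /= -gE.
exists (g \o id'); split => //.
- by move=> B mB; have := mg measurableT B mB; rewrite setTI.
- move=> A FA; have := Radon_Nikodym_integral nuP FA.
  rewrite -(eq_integral _ _ (fun x _ => gE x)) integral_pushforward//.
  by apply: integrableS intg => //; exact: sub_sigma.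
Qed.

(** On an event of the sub-sigma-algebra [f] and its conditional expectation have the same integral,
    and an [L^1] norm dominates the integral over any event. This turns a mixing coefficient into a
    bound on expectations. *)
Lemma cond_exp_indic (f : T -> R) A (e : R) : bmeas f -> <<s G >> A ->
  (`|Rintegral P setT (fun x => \1_A x * (f x - e))|%:E <=
   'N[P]_1[EFin \o (cond_exp P <<s G >> f \- cst e)%R])%E.
Proof.
move=> bf FA; have mA := sub_sigma FA.
have [intg _ gA] : is_cond_exp P <<s G >> f (cond_exp P <<s G >> f).
  by have [g gP] := cond_exp_exists bf; exact: xgetPex (ex_intro _ _ gP).
set g := cond_exp _ _ _ in intg gA *.
have be : bmeas (fun _ : T => e) := bmeas_cst _ e.
have ifA := bmeas_integrable P mA bf; have ieA := bmeas_integrable P mA be.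
have igA : P.-integrable A (EFin \o g) by exact: integrableS intg.
have ige : P.-integrable setT (fun x => (g x - e)%:E).
  exact: (integrableB measurableT intg (bmeas_integrable P measurableT be)).
rewrite exp_indicM// EFin_normr_Rintegral//; last first.
  by apply: bmeas_integrable => //; exact: bmeasB.
rewrite integralB_EFin// -gA// -integralB_EFin// Lnorm1.
apply: (le_trans (le_abse_integral _ _ _)) => //.
  by apply: measurable_funTS; exact: measurable_int ige.
apply: ge0_subset_integral => //.
by apply: measurableT_comp => //; exact: measurable_int ige.
Qed.

End conditional_expectation.

(** Both directions are allowed because [H_Y] decreases while [G_X] increases. *)
Definition mono01 (R : realType) (h : R -> R) :=
  (nonincreasing_fun h \/ nondecreasing_fun h) /\ forall x, 0 <= h x <= 1.

Lemma mono01_measurable (R : realType) (h : R -> R) :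
  mono01 h -> measurable_fun setT h.
Proof.
by move=> [[hm|hm] _];
  [exact: nonincreasing_measurable|exact: nondecreasing_measurable].
Qed.

Lemma mono01_bmeas d (T : measurableType d) (R : realType) (Z : T -> R)
  (h : R -> R) :
  measurable_fun setT Z -> mono01 h -> bmeas (h \o Z).
Proof.
move=> mZ hm; apply: bmeas_le1 => [|x].
  by apply: measurableT_comp => //; exact: mono01_measurable.
by have /andP[h0 h1] := hm.2 (Z x); rewrite /= ger0_norm.
Qed.

Lemma bmeas_bool d (T : measurableType d) (R : realType) (p : T -> bool) :
  measurable_fun setT p -> bmeas (fun x => (p x)%:R : R).
Proof.
move=> mp; apply: bmeas_le1 => [|x]; last by case: (p x);
  rewrite ?normr1 ?normr0.
rewrite (_ : (fun _ => _) = fun x => if p x then 1 else 0).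
  by apply: measurable_fun_ifT => //; exact: measurable_cst.
by apply/funext => x; case: (p x).
Qed.

(** * From half-line indicators to monotone functions *)

Section threshold.
Context d (T : measurableType d) (R : realType) (P : probability T R).
Local Notation E f := (Rintegral P setT f).
Variables (phi Z : T -> R) (c : R).
Hypotheses (bphi : bmeas phi) (mZ : measurable_fun setT Z).

Section uncentered.
Hypothesis Hle : forall x, `|E (fun w => phi w * (Z w <= x)%R%:R)| <= c.
Hypothesis H1 : `|E phi| <= c.

Let bmeas_le x : bmeas (fun w => (Z w <= x)%R%:R : R).
Proof. by apply: bmeas_bool; exact: measurable_fun_ler. Qed.

(** An open half-line is the increasing union of the closed ones ending at [x - 1/(n+1)]. *)
Lemma corr_lt_le x : `|E (fun w => phi w * (Z w < x)%R%:R)| <= c.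
Proof.
have [M phiM] := bphi.2.
have : E (fun w => phi w * (Z w <= x - n.+1%:R^-1)%R%:R) @[n --> \oo] -->
       E (fun w => phi w * (Z w < x)%R%:R).
  apply: (exp_cvg (M := M)) => [n|n w|w].
  - exact: bmeasM.
  - rewrite normrM -[leRHS]mulr1 ler_pM//.
    by case: (Z w <= _); rewrite ?normr1 ?normr0.
  - apply: cvgMr; have [Zx|xZ] := ltP (Z w) x; last first.
      rewrite (_ : (fun _ => _) = fun=> 0); first exact: cvg_cst.
      apply/funext => n; rewrite leNgt (lt_le_trans _ xZ)//.
      by rewrite ltrBlDr ltrDl invr_gt0.
    have := near_infty_natSinv_lt (PosNum (eqbRL (subr_gt0 _ _) Zx)).
    rewrite /= => near_lt; apply: cvg_near_cst; near=> n.
    have -> // : (Z w <= x - n.+1%:R^-1) = true.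
    by rewrite lerBrDr -lerBrDl; apply/ltW; near: n.
move=> /cvg_norm cv; rewrite -(cvg_lim _ cv)//; apply: limr_le.
  by apply/cvg_ex; eexists; exact: cv.
by apply: nearW => n; exact: Hle.
Unshelve. all: by end_near. Qed.

(** A down-set of the line is everything, empty, or the closed or open half-line ending at its
    supremum. [H1] settles the first two cases, the second through [0 <= c]. *)
Lemma corr_down_le (p : R -> bool) : (forall x y, x <= y -> p y -> p x) ->
  `|E (fun w => phi w * (p (Z w))%:R)| <= c.
Proof.
move=> pd.
have [pT|] := pselect (forall x, p x).
  by rewrite (eq_exp _ (g := phi))// => w; rewrite pT mulr1.
move=> /existsNP[b /negP pb].
have [[a pa]|p0] := pselect (exists a, p a); last first.
  rewrite (eq_exp _ (g := fun=> 0)) ?exp_cst ?normr0 ?(le_trans _ H1)// => w.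
  by rewrite (_ : p _ = false) ?mulr0//; apply/negP => pw; apply: p0;
    exists (Z w).
have ubp : has_ubound [set x | p x].
  by exists b => x /= px; rewrite leNgt; apply/negP => /ltW /pd /(_ px);
    exact/negP.
have lts x : x < sup [set x | p x] -> p x.
  move=> xs; have sx0 : 0 < sup [set x | p x] - x by rewrite subr_gt0.
  have [y /= py xy] := sup_adherent sx0 (conj (ex_intro _ a pa) ubp).
  by move: xy; rewrite subKr => /ltW /pd; exact.
have ps : p (sup [set x | p x]) = true \/ p (sup [set x | p x]) = false.
  by case: (p _); [left|right].
set s := sup _ in lts ps *.
have lex x : p x -> x <= s by move=> px; exact: ub_le_sup.
case: ps => ps.
  rewrite (eq_exp _ (g := fun w => phi w * (Z w <= s)%R%:R))// => w.
  congr (_ * (nat_of_bool _)%:R); apply/idP/idP => [/lex//|/pd]; exact.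
rewrite (eq_exp _ (g := fun w => phi w * (Z w < s)%R%:R));
  first exact: corr_lt_le.
move=> w; congr (_ * (nat_of_bool _)%:R); apply/idP/idP => [pz|/lts//].
by rewrite lt_neqAle lex// andbT; apply: contraTneq pz => ->; rewrite ps.
Qed.

(** The sum counts the naturals below [y], so it is the ceiling of [y]. *)
Lemma sum_lt_bounds (y : R) N : 0 <= y <= N%:R ->
  y <= \sum_(r < N) ((r%:R < y)%R%:R : R) <= y + 1.
Proof.
move=> /andP[y0 yN].
(* The bound [y <= N] does not survive the induction on [N]; it is replaced by the alternative that
   the count is saturated or already at least [y]. *)
have : let s := \sum_(r < N) ((r%:R < y)%R%:R : R) in
    [/\ s <= N%:R, s <= y + 1 & N%:R <= s \/ y <= s].
  move=> /=; elim: N {yN} => [|N [sN sy Ns]].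
    by rewrite big_ord0 lexx addr_ge0//; split => //; left.
  rewrite big_ord_recr/= -natr1.
  have [Ny|Ny] := ltP N%:R y; rewrite /= ?mulr0n ?mulr1n ?addr0.
    by split; [lra|lra|left; case: Ns => ?; lra].
  by split; [lra|lra|right; case: Ns => ?; lra].
by move=> [_ -> [|->//]]; rewrite andbT => /(le_trans yN).
Qed.

(* [h] is the limit of the averages of the indicators of the down-sets
   [{h > r / n}], [r < n]. *)
Lemma corr_nonincreasing_le (h : R -> R) : nonincreasing_fun h ->
  (forall x, 0 <= h x <= 1) -> `|E (fun w => phi w * h (Z w))| <= c.
Proof.
move=> hd h01.
have [M phiM] := bphi.2.
have M0 : 0 <= M := le_trans (normr_ge0 _) (phiM point).
pose hN n z : R := n.+1%:R^-1 * \sum_(r < n.+1) (r%:R < n.+1%:R * h z)%R%:R.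
have b_ n (r : nat) : bmeas (fun w => (r%:R < n.+1%:R * h (Z w))%R%:R : R).
  apply: bmeas_bool; apply: measurable_fun_ltr => //.
  apply: measurable_funM => //; apply: measurableT_comp => //.
  exact: nonincreasing_measurable.
(* Rounding [(n+1) h z] up to an integer changes it by at most 1. *)
have hNE n z : `|hN n z - h z| <= n.+1%:R^-1.
  rewrite /hN; have /andP[h0 h1] := h01 z.
  have n0 : 0 < n.+1%:R :> R by rewrite ltr0n.
  have hn : 0 <= n.+1%:R * h z <= n.+1%:R by rewrite mulr_ge0//= ler_piMr.
  have /andP[lo up] := sum_lt_bounds hn.
  rewrite -(ler_pM2l n0) divff ?gt_eqF// -{1}(ger0_norm (ltW n0)) -normrM mulrBr
    mulrA divff ?gt_eqF// mul1r.
  rewrite ger0_norm; lra.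
have hN1 n z : `|hN n z| <= 2.
  have /andP[h0 h1] := h01 z.
  have n0 : n.+1%:R^-1 <= 1 :> R by rewrite invf_le1 ?ler1n ?ltr0n.
  have := ler_normD (hN n z - h z) (h z); rewrite subrK (ger0_norm h0).
  by move=> /le_trans; apply; rewrite -[2]/(1 + 1) lerD// (le_trans (hNE _ _)).
have : E (fun w => phi w * hN n (Z w)) @[n --> \oo] --> E
  (fun w => phi w * h (Z w)).
  apply: (exp_cvg (M := M * 2)) => [n|n w|w].
  - by apply: bmeasM => //; apply: bmeasM; [exact: bmeas_cst|apply: bmeas_sum].
  - by rewrite normrM ler_pM.
  - apply: cvgMr; apply/cvgrPdist_le => e e0.
    near=> n; rewrite distrC (le_trans (hNE _ _))//; apply/ltW; near: n.
    exact: (near_infty_natSinv_lt (PosNum e0)).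
move=> /cvg_norm cv; rewrite -(cvg_lim _ cv)//; apply: limr_le.
  by apply/cvg_ex; eexists; exact: cv.
apply: nearW => n.
have -> : E (fun w => phi w * hN n (Z w)) =
    n.+1%:R^-1 * \sum_(r < n.+1) E
      (fun w => phi w * (r%:R < n.+1%:R * h (Z w))%R%:R).
  rewrite -exp_sum; last by move=> r; exact: bmeasM.
  rewrite -expZl; last by apply: bmeas_sum => r; exact: bmeasM.
  by apply: eq_exp => w; rewrite /hN mulrCA mulr_sumr.
rewrite normrM ger0_norm ?invr_ge0// ler_pdivrMl ?ltr0n//.
apply: (le_trans (ler_norm_sum _ _ _)).
rewrite [leRHS](_ : _ = \sum_(r < n.+1) c);
  last by rewrite sumr_const card_ord mulr_natl.
apply: ler_sum => r _.
apply: (@corr_down_le (fun z => r%:R < n.+1%:R * h z)) => x y xy /lt_le_trans;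
  apply.
by rewrite ler_pM2l ?ltr0n// hd.
Unshelve. all: by end_near. Qed.

End uncentered.
End threshold.

Section centered_threshold.
Context d (T : measurableType d) (R : realType) (P : probability T R).
Local Notation E f := (Rintegral P setT f).
Implicit Types f g phi Z : T -> R.

(** Both sides are the covariance of [phi] and [g]. *)
Lemma exp_centerM phi g : bmeas phi -> bmeas g ->
  E (fun w => phi w * (g w - E g)) = E (fun w => (phi w - E phi) * g w).
Proof.
move=> bp bg; have bc r : bmeas (fun _ : T => r) := bmeas_cst _ r.
transitivity (E (fun w => phi w * g w) - E phi * E g).
  rewrite -expZr// -expB//; [|exact: bmeasM..].
  by apply: eq_exp => w; rewrite mulrBr.
rewrite -expZl// -expB//; [|exact: bmeasM..].
by apply: eq_exp => w; rewrite mulrBl.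
Qed.

(** Moving the centring onto [phi] gives a weight of mean 0. The bound on the mean of the weight is
    then automatic, and a nondecreasing [h] may be replaced by the nonincreasing [1 - h] at the
    price of a sign. *)
Lemma corr_mono01_le phi Z (h : R -> R) c : bmeas phi ->
  measurable_fun setT Z ->
  mono01 h ->
  (forall x, `|E (fun w => phi w *
    ((Z w <= x)%R%:R - E (fun w => (Z w <= x)%R%:R)))| <= c) ->
  `|E (fun w => phi w * (h (Z w) - E (h \o Z)))| <= c.
Proof.
move=> bp mZ hm H.
have bc r : bmeas (fun _ : T => r) := bmeas_cst _ r.
have bphi' : bmeas (fun w => phi w - E phi) by exact: bmeasB.
have b0 : E (fun w => phi w - E phi) = 0 by rewrite expB// exp_cst subrr.
have H0 : `|E (fun w => phi w - E phi)| <= c.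
  by rewrite b0 normr0 (le_trans _ (H 0)).
have Hle x : `|E (fun w => (phi w - E phi) * (Z w <= x)%R%:R)| <= c.
  by rewrite -exp_centerM//; apply: bmeas_bool; exact: measurable_fun_ler.
have bh := mono01_bmeas mZ hm.
rewrite exp_centerM//.
case: hm => -[hd|hi] h01; first exact: corr_nonincreasing_le.
have := @corr_nonincreasing_le _ _ _ P _ _ _ bphi' mZ Hle H0 (fun x => 1 - h x).
rewrite (_ : E (fun w => _ * (1 - h (Z w))) =
  - E (fun w => (phi w - E phi) * h (Z w))).
  rewrite normrN; apply=> [x y xy|x]; first by rewrite lerB// hi.
  by have := h01 x; lra.
rewrite -[RHS]add0r -b0 -expB//; last exact: bmeasM.
by apply: eq_exp => w; rewrite mulrBr mulr1.
Qed.

End centered_threshold.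

(** * Mixing bounds for stationary processes *)

Section stationarity.
Context d (T : measurableType d) (R : realType) (P : probability T R).
Local Notation E f := (Rintegral P setT f).
Variable X : int -> {RV P >-> R}.
Hypothesis statX : strictly_stationary X.

(** Both expectations integrate one function of a [k]-tuple against the laws of the shifted and
    unshifted tuples, which stationarity identifies. *)
Lemma stationary_exp k (t : 'I_k -> int) (h : int) (g : 'I_k -> R -> R) :
  (forall l, bmeas (g l)) ->
  E (fun w => \prod_(l < k) g l (X (t l + h) w)) =
  E (fun w => \prod_(l < k) g l (X (t l) w)).
Proof.
move=> bg.
pose Phi (s : 'I_k -> int) w : k.-tuple R := [tuple X (s l) w | l < k].
have mPhi s : measurable_fun setT (Phi s).
  apply/measurable_fun_tnthP => l.
  rewrite (_ : _ \o _ = X (s l)) //.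
  by apply/funext => w; rewrite /= tnth_mktuple.
pose G (u : k.-tuple R) := \prod_(l < k) g l (tnth u l).
have bG : bmeas G by apply: bmeas_prod => l; apply: bmeas_comp => //;
  exact: measurable_tnth.
pose Phim s : {mfun T >-> k.-tuple R} :=
  HB.pack (Phi s) (@isMeasurableFun.Build _ _ _ _ (Phi s) (mPhi s)).
have EE s : E (fun w => \prod_(l < k) g l (X (s l) w)) =
    fine (\int[distribution P (Phim s)]_u (G u)%:E).
  rewrite integral_distribution.
  - by congr fine; apply: eq_integral => w _ /=; congr EFin;
    apply: eq_bigr => l _; rewrite tnth_mktuple.
  - by apply/measurable_EFinP; exact: bG.1.
  - by apply: bmeas_integrable => //; exact: bmeas_comp.
rewrite (EE (fun l => t l + h)) EE; congr fine;
  apply: eq_measure_integral => A mA _.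
have := statX [tuple t l | l < k] h mA.
rewrite /distribution /pushforward /= /Phi => sX.
transitivity (P [set w | A
  [tuple X (tnth [tuple t l | l < k] l + h) w | l < k]]).
  congr (P _); apply/seteqP; split => w /=;
    under eq_mktuple do rewrite tnth_mktuple; done.
rewrite sX.
by congr (P _); apply/seteqP; split => w /=;
  under eq_mktuple do rewrite tnth_mktuple.
Qed.

End stationarity.

(** * Testing against bounded functions of the past *)

Section past.
Context d (T : measurableType d) (R : realType) (P : probability T R).
Local Notation E f := (Rintegral P setT f).
Variable X : int -> {RV P >-> R}.

Let gens := \bigcup_(i in [set k : int | k <= 0]) preimage_set_system setT (X i)
  measurable.

Let gens_sub : gens `<=` measurable.
Proof. by move=> A [i _ [B mB <-]]; rewrite setTI -[X in measurable X]setTI;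
  exact: measurable_funPT. Qed.

(** Stated on the generated measurable space, so that the closure of measurable functions under
    products and differences applies to past variables. *)
Definition past_measurable (A : T -> R) :=
  measurable_fun setT (A : g_sigma_algebraType gens -> R).

Lemma past_measurable_process k : k <= 0 -> past_measurable (X k).
Proof.
by move=> k0 _ B mB; apply: sub_sigma_algebra; exists k => //; exists B.
Qed.

Lemma past_measurable_sub (A : T -> R) : past_measurable A ->
  measurable_fun setT A.
Proof.
move=> mA _ B mB; have : <<s gens >> ([set: T] `&` A @^-1` B) by exact: mA.
by apply: smallest_sub => //; exact: sigma_algebra_measurable.
Qed.

(* The events [{- A <= x}] belong to the past, so the threshold bounds apply to
   [A] itself through a monotone function of [- A]. *)
Lemma past_cov_le (A f : T -> R) (c : R) : past_measurable A ->
  (forall w, `|A w| <= 1) -> bmeas f -> (L1_dev X f (E f) <= c%:E)%E ->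
  `|E (fun w => A w * (f w - E f))| <= 2 * c.
Proof.
move=> pA A1 bf fc.
have mA := past_measurable_sub pA.
have bc r : bmeas (fun _ : T => r) := bmeas_cst _ r.
pose phi w := f w - E f.
have bphi : bmeas phi by exact: bmeasB.
have phi0 : E phi = 0 by rewrite expB// exp_cst subrr.
have c0 : 0 <= c by rewrite -lee_fin (le_trans _ fc)// Lnorm_ge0.
(* The roles are swapped: the centred [f] is the weight and [- A] is thresholded. Since [A] has
   values in [[-1, 1]], the clamp is inactive at [- A], where [A = 2 h(- A) - 1]; this is the origin
   of the factor 2. *)
pose h (z : R) := Num.max 0 (Num.min 1 ((1 - z) / 2)).
have mN : measurable_fun setT (fun w => - A w) by exact: measurableT_comp.
have Hle x : `|E (fun w => phi w * (- A w <= x)%R%:R)| <= c.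
  have FA : <<s gens >> [set w | - A w <= x].
    have := pA measurableT _ (measurable_itv `[- x, +oo[).
    rewrite setTI; congr (<<s gens >> _); apply/seteqP; split=> w /=;
    by rewrite in_itv/= andbT lerNl.
  rewrite -lee_fin; apply: le_trans fc.
  have := cond_exp_indic P gens_sub (E f) bf FA; congr (_ <= _)%E.
  congr (`|_|%:E); apply: eq_exp => w; rewrite mulrC indicE.
  by congr (_ * (nat_of_bool _)%:R); apply/idP/idP; rewrite inE.
have := @corr_nonincreasing_le _ _ _ P phi (fun w => - A w) c bphi mN Hle _ h.
rewrite phi0 normr0 => /(_ c0) H.
have hA w : h (- A w) = (1 + A w) / 2.
  by have := A1 w; rewrite /h ler_norml => /andP[? ?]; rewrite min_r ?max_r;
    lra.
have -> : E (fun w => A w * phi w) = 2 * E (fun w => phi w * h (- A w)) - E phi.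
  have bA : bmeas A by exact: bmeas_le1.
  have bh : bmeas (fun w => phi w * h (- A w)).
    apply: bmeasM => //; under eq_fun do rewrite hA.
    by apply: bmeasM; [exact: bmeasD|exact: bmeas_cst].
  rewrite -expZl// -expB//; first by apply: eq_exp => w; rewrite hA; field.
  by apply: bmeasM => //; exact: bmeas_cst.
rewrite phi0 subr0 normrM ger0_norm// ler_pM2l//; apply: H.
  by move=> x y xy; apply: le_max2 => //; apply: le_min2 => //; lra.
by move=> x; rewrite /h le_max lexx ge_max ler01 ge_min lexx.
Qed.

End past.

Section mixing.
Context d (T : measurableType d) (R : realType) (P : probability T R).
Local Notation E f := (Rintegral P setT f).
Variable X : int -> {RV P >-> R}.
Hypothesis statX : strictly_stationary X.
Variable al : nat -> R.
Hypothesis alX : forall k, (0 < k)%N -> (alpha2 X k <= (al k)%:E)%E.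

Lemma stationary_exp1 (g : R -> R) (k : int) : bmeas g ->
  E (fun w => g (X k w)) = E (fun w => g (X 0 w)).
Proof.
move=> bg; have := stationary_exp statX (fun _ : 'I_1 => 0) k (fun=> bg).
rewrite (eq_exp _ (g := fun w => g (X k w))); last by move=> w;
  rewrite big_ord1 add0r.
by move=> ->; apply: eq_exp => w; rewrite big_ord1.
Qed.

Lemma bmeas_leR (x : R) : bmeas (fun z : R => (z <= x)%R%:R : R).
Proof. by apply: bmeas_bool; exact: measurable_fun_ler. Qed.

Lemma exp_F_of x k : E (fun w => (X k w <= x)%R%:R) = F_of X x.
Proof.
rewrite (@stationary_exp1 (fun z => (z <= x)%R%:R))//; last exact: bmeas_leR.
rewrite /F_of /cdf /distribution /pushforward -exp_indic; last first.
  by rewrite -[X in measurable X]setTI; exact: measurable_funPT.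
apply: eq_exp => w; rewrite indicE.
by congr ((nat_of_bool _)%:R); apply/idP/idP; rewrite inE/= in_itv.
Qed.

Lemma L1_dev_alpha1 x n : (0 < n)%N ->
  (L1_dev X (fun w => (X n w <= x)%R%:R) (E (fun w => (X n w <= x)%R%:R)) <=
    (al n)%:E)%E.
Proof.
move=> n0; apply: le_trans (alX n0); rewrite /alpha2 le_max; apply/orP; left.
by apply: ereal_sup_ubound; exists x => //; rewrite exp_F_of.
Qed.

Lemma L1_dev_alpha2 x y n i j (f : T -> R) : (0 < n)%N -> (n <= i <= j)%N ->
  f = (fun w => centered_ind X x (X i w) * centered_ind X y (X j w)) ->
  (L1_dev X f (E f) <= (al n)%:E)%E.
Proof.
move=> n0 /andP[ni ij] ->.
apply: le_trans (alX n0); rewrite /alpha2 le_max; apply/orP; right.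
apply: ereal_sup_ubound; exists x, y, i, j; split => //.
by rewrite unlock.
Qed.

Variable h : R -> R.
Hypothesis hm : mono01 h.

Definition centered_at (k : int) w := h (X k w) - E (fun w => h (X 0 w)).
Local Notation W := centered_at.

Lemma bmeas_mono01_process (k : int) : bmeas (fun w => h (X k w)).
Proof. exact: (mono01_bmeas (Z := X k)). Qed.

Lemma mono01_bmeas_id : bmeas h.
Proof. exact: (mono01_bmeas (Z := id)). Qed.

Lemma bmeas_centered_at k : bmeas (W k).
Proof. by apply: bmeasB; [exact: bmeas_mono01_process|exact: bmeas_cst]. Qed.

Lemma exp_mono01_itv : 0 <= E (fun w => h (X 0 w)) <= 1.
Proof.
rewrite exp_ge0; last by move=> w; have /andP[] := hm.2 (X 0 w).
rewrite -[leRHS](exp_cst P); apply: le_exp;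
  [exact: bmeas_mono01_process|exact: bmeas_cst|].
by move=> w; have /andP[] := hm.2 (X 0 w).
Qed.

Lemma centered_at_le1 k w : `|W k w| <= 1.
Proof.
have := exp_mono01_itv; have := hm.2 (X k w); rewrite /W ler_norml.
by move=> /andP[? ?] /andP[? ?]; apply/andP; split; lra.
Qed.

Lemma centered_atE k w : W k w = h (X k w) - E (h \o X k).
Proof. by rewrite /W -(@stationary_exp1 h k)//; exact: mono01_bmeas_id. Qed.

Lemma centered_indE x k w : centered_ind X x (X k w) =
  (X k w <= x)%R%:R - E (fun w => (X k w <= x)%R%:R).
Proof. by rewrite exp_F_of. Qed.

Lemma bmeas_centered_ind x k : bmeas (fun w => centered_ind X x (X k w)).
Proof.
by apply: bmeasB; [exact: (bmeas_comp _ (bmeas_leR x))|exact: bmeas_cst].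
Qed.

(** Two reductions meet here: [h (X n)] is replaced by indicators of half-lines, and [past_cov_le]
    replaces [A] by events of the past. Only [alpha1] remains. *)
Lemma past_corr_le A n : past_measurable X A -> (forall w, `|A w| <= 1) ->
  (0 < n)%N ->
  `|E (fun w => A w * W n w)| <= 2 * al n.
Proof.
move=> pA A1 n0; have bA : bmeas A := bmeas_le1 (past_measurable_sub pA) A1.
rewrite (eq_exp _ (g := fun w => A w * (h (X n w) - E (h \o X n))));
  last by move=> w; rewrite centered_atE.
apply: corr_mono01_le => // x.
apply: (past_cov_le pA) => //; last exact: L1_dev_alpha1.
exact: (bmeas_comp (measurable_funPT (X n)) (bmeas_leR x)).
Qed.

(** The values of [h] at [X i] and [X j] are replaced by half-line indicators one at a time, the
    other factors being absorbed in the weight. What remains is the joint part of [alpha2]. *)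
Lemma past_cov_pair_le A n i j : past_measurable X A ->
  (forall w, `|A w| <= 1) ->
  (0 < n)%N -> (n <= i <= j)%N ->
  `|E (fun w => A w * (W i w * W j w)) - E A * E (fun w => W i w * W j w)| <=
    2 * al n.
Proof.
move=> pA A1 n0 nij; have bA : bmeas A := bmeas_le1 (past_measurable_sub pA) A1.
have bW := bmeas_centered_at; have bci := bmeas_centered_ind.
have bA' : bmeas (fun w => A w - E A) by apply: bmeasB => //; exact: bmeas_cst.
(* Centring [A] makes the difference a single expectation, linear in the centred value of
   [h (X i)]. *)
have -> : E (fun w => A w * (W i w * W j w)) - E A *
  E (fun w => W i w * W j w) =
    E (fun w => (A w - E A) * W j w * (h (X i w) - E (h \o X i))).
  have bWW := bmeasM (bW i) (bW j).
  rewrite -expZl// -expB//;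
    [|exact: bmeasM|by apply: bmeasM => //; exact: bmeas_cst].
  by apply: eq_exp => w; rewrite -centered_atE; ring.
apply: corr_mono01_le => //; first exact: bmeasM.
move=> x.
rewrite (eq_exp _ (g := fun w => (A w - E A) * centered_ind X x (X i w) *
  (h (X j w) - E (h \o X j)))); last first.
  by move=> w; rewrite -centered_atE centered_indE; ring.
apply: corr_mono01_le => //; first exact: bmeasM.
move=> y.
rewrite (eq_exp _ (g := fun w => (A w - E A) *
  (centered_ind X x (X i w) * centered_ind X y (X j w)))); last first.
  by move=> w; rewrite !centered_indE; ring.
(* The centring goes back from [A] to the product of indicators, which is the form that
   [alpha2_joint] measures. *)
rewrite -exp_centerM//; last exact: bmeasM.
by apply: (past_cov_le pA) => //; [exact: bmeasM|exact: (L1_dev_alpha2 n0 nij)].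
Qed.

End mixing.

(** * Second and fourth moments of the centred values *)

Section moment_bounds.
Context d (T : measurableType d) (R : realType) (P : probability T R).
Local Notation E f := (Rintegral P setT f).
Variable X : int -> {RV P >-> R}.
Hypothesis statX : strictly_stationary X.
Variable al : nat -> R.
Hypothesis alX : forall k, (0 < k)%N -> (alpha2 X k <= (al k)%:E)%E.
(* Gap 0 is bounded trivially, so [al 0] is not tied to [alpha2 X 0]. *)
Hypothesis al0 : al 0 = 1.
Variable h : R -> R.
Hypothesis hm : mono01 h.
Local Notation W := (centered_at X h).

Let bW k : bmeas (W k). Proof. exact: bmeas_centered_at. Qed.
Let W1 k w : `|W k w| <= 1. Proof. exact: centered_at_le1. Qed.

Let bmeas_center : bmeas (fun z => h z - E (fun w => h (X 0 w))).
Proof. by apply: bmeasB; [exact: mono01_bmeas_id|exact: bmeas_cst]. Qed.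

Lemma moment2_shift (a b s : int) :
  E (fun w => W a w * W b w) = E (fun w => W (a + s) w * W (b + s) w).
Proof.
have eqE (t : 'I_2 -> int) :
    E (fun w => \prod_(l < 2) (h (X (t l) w) - E (fun w => h (X 0 w)))) =
    E (fun w => W (t ord0) w * W (t (lift ord0 ord0)) w).
  by apply: eq_exp => w; rewrite !big_ord_recl big_ord0 mulr1.
have := stationary_exp statX (fun l : 'I_2 => nth 0 [:: a; b] l) s
  (fun=> bmeas_center).
by rewrite !eqE.
Qed.

Lemma moment4_shift (a b c e s : int) :
  E (fun w => W a w * W b w * (W c w * W e w)) =
  E (fun w => W (a + s) w * W (b + s) w * (W (c + s) w * W (e + s) w)).
Proof.
have eqE (t : 'I_4 -> int) :
    E (fun w => \prod_(l < 4) (h (X (t l) w) - E (fun w => h (X 0 w)))) =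
    E (fun w => W (t ord0) w * W (t (lift ord0 ord0)) w *
      (W (t (lift ord0 (lift ord0 ord0))) w *
        W (t (lift ord0 (lift ord0 (lift ord0 ord0)))) w)).
  by apply: eq_exp => w; rewrite !big_ord_recl big_ord0 mulr1 mulrA.
have := stationary_exp statX (fun l : 'I_4 => nth 0 [:: a; b; c; e] l) s
  (fun=> bmeas_center).
by rewrite !eqE.
Qed.

Lemma past_measurable_centered_at k : k <= 0 -> past_measurable X (W k).
Proof.
move=> k0; apply: (measurable_funB _ (measurable_cst _)).
by apply: measurableT_comp;
  [exact: mono01_measurable|exact: past_measurable_process].
Qed.

Lemma normM_le1 (x y : R) : `|x| <= 1 -> `|y| <= 1 -> `|x * y| <= 1.
Proof. by move=> x1 y1; rewrite normrM mulr_ile1. Qed.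

Lemma moment2_le (c e : nat) : (c <= e)%N -> `|E (fun w => W c w * W e w)| <=
  2 * al (e - c).
Proof.
rewrite leq_eqVlt => /predU1P[<-|ce].
  rewrite subnn al0 mulr1; apply: (le_trans (y := 1)); last by rewrite ler1n.
  by apply: norm_exp_le; [exact: bmeasM|move=> w; exact: normM_le1].
rewrite (moment2_shift _ _ (- c%:Z)) subrr (subzn (ltnW ce)).
apply: (past_corr_le statX alX hm) => //; last by rewrite subn_gt0.
exact: past_measurable_centered_at.
Qed.

(** After a shift by [- c] the first three factors form one past variable bounded by 1, so the last
    gap alone counts. *)
Lemma moment4_le (a b c e : nat) : (a <= c)%N -> (b <= c)%N -> (c <= e)%N ->
  `|E (fun w => W a w * W b w * (W c w * W e w))| <= 2 * al (e - c).
Proof.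
move=> ac bc; rewrite leq_eqVlt => /predU1P[<-|ce].
  rewrite subnn al0 mulr1; apply: (le_trans (y := 1)); last by rewrite ler1n.
  apply: norm_exp_le; first by do ?apply: bmeasM.
  by move=> w; do ?apply: normM_le1.
rewrite (moment4_shift _ _ _ _ (- c%:Z)) subrr (subzn (ltnW ce)).
under eq_exp do rewrite mulrA.
apply: (past_corr_le statX alX hm (A := fun w => W _ w * W _ w * W _ w));
  last by rewrite subn_gt0.
  by do 2?apply: measurable_funM; apply: past_measurable_centered_at => //;
    rewrite subr_le0 lez_nat.
by move=> w; do ?apply: normM_le1.
Qed.

(** After a shift by [- b] the first pair lies in the past and the second pair starts at time
    [c - b]. At gap 0 the two terms are at most 1 each, which is [2 * al 0]. *)
Lemma cov4_le (a b c e : nat) : (a <= b)%N -> (b <= c)%N -> (c <= e)%N ->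
  `|E (fun w => W a w * W b w * (W c w * W e w)) -
    E (fun w => W a w * W b w) * E (fun w => W c w * W e w)| <= 2 * al (c - b).
Proof.
move=> ab; rewrite leq_eqVlt => /predU1P[<-|bc] ce.
  rewrite subnn al0 mulr1; apply: (le_trans (ler_normB _ _)).
  rewrite -[leRHS]/(1 + 1) lerD//.
    apply: norm_exp_le; first by do ?apply: bmeasM.
    by move=> w; do ?apply: normM_le1.
  by apply: normM_le1;
    (apply: norm_exp_le; [exact: bmeasM|move=> w; exact: normM_le1]).
rewrite (moment4_shift _ _ _ _ (- b%:Z)) (moment2_shift a b (- b%:Z))
  (moment2_shift c e (- b%:Z)).
rewrite (subzn (ltnW bc)) (subzn (leq_trans (ltnW bc) ce)).
apply: (past_cov_pair_le statX alX hm (A := fun w => W _ w * W _ w)).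
- by apply: measurable_funM; apply: past_measurable_centered_at;
  rewrite ?subr_le0 ?lez_nat.
- by move=> w; exact: normM_le1.
- by rewrite subn_gt0.
- by rewrite leqnn leq_sub2r.
Qed.

End moment_bounds.

(** * Variance of the truncated long-run variance *)

Section summable_bounds.
Variables (R : realType) (al : nat -> R) (A : R).
Hypothesis al_ge0 : forall k, 0 <= al k.
Hypothesis al_sum : forall N, \sum_(k < N) al k <= A.

Lemma sum_uniq_le (s : seq nat) : uniq s -> \sum_(k <- s) al k <= A.
Proof.
move=> us; pose N := (\max_(k <- s) k).+1.
apply: le_trans (al_sum N); rewrite -(big_mkord xpredT al).
have pm : perm_eq s [seq k <- index_iota 0 N | k \in s].
  apply: uniq_perm => //; first exact/filter_uniq/iota_uniq.
  move=> k; rewrite mem_filter mem_index_iota/= ltnS;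
    have [ks|//] := boolP (k \in s).
  by rewrite (@leq_bigmax_seq _ s xpredT id).
by rewrite (perm_big _ pm) big_filter big_mkcond/=; apply: ler_sum => k _;
  case: ifP.
Qed.

(** Used with [f] a gap between indices: the selected indices have distinct gaps, so the whole
    series dominates the sum. *)
Lemma sum_inj_le N (p : pred nat) (f : nat -> nat) :
  (forall x y, p x -> p y -> f x = f y -> x = y) ->
    \sum_(l < N) (p l)%:R * al (f l) <= A.
Proof.
move=> inj_f.
rewrite -(big_mkord xpredT (fun l => (p l)%:R * al (f l))).
rewrite (eq_bigr (fun l => if p l then al (f l) else 0)); last first.
  by move=> l _; case: (p l); rewrite ?mul1r ?mul0r.
rewrite -big_mkcond -big_filter -(big_map f xpredT al).
apply: sum_uniq_le; rewrite map_inj_in_uniq; first exact/filter_uniq/iota_uniq.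
by move=> x y; rewrite !mem_filter => /andP[px _] /andP[py _]; exact: inj_f.
Qed.

(** Subtraction being truncated, one summand vanishes: this is the distance between [i] and [j]. *)
Definition distn (i j : nat) := ((i - j) + (j - i))%N.

(** Each distance occurs at most once on either side of [i]. *)
Lemma sum_distn_le N (i c : nat) : \sum_(l < N) al (distn i (c + l)) <= 2 * A.
Proof.
have -> : 2 * A = A + A by rewrite mulrDl mul1r.
apply: (@le_trans _ _ (\sum_(l < N) (((c + l <= i)%N)%:R * al (i - (c + l)) +
                       ((i <= c + l)%N)%:R * al ((c + l) - i)))); last first.
  rewrite big_split/= lerD//.
    by apply: (@sum_inj_le _ (fun l => c + l <= i)%N (fun l => i - (c + l))%N)
      => x y /=; lia.
  by apply: (@sum_inj_le _ (fun l => i <= c + l)%N (fun l => (c + l) - i)%N) =>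
    x y /=; lia.
apply: ler_sum => l _; rewrite /distn.
have [li|il] := leqP (c + l) i.
  rewrite (eqP li) addn0 mul1r lerDl mulr_ge0//.
by rewrite ltnW// mul1r mul0r add0r (eqP (ltnW il)) add0n.
Qed.

(* Bounds the covariance of [W_i W_(i+k)] and [W_j W_(j+l)] for [i <= j]: by the
   middle gap when [i + k <= j], otherwise by the last gap for the fourth moment
   and by [al k] for the product of the two second moments. *)
Definition cov_bound (k i l j : nat) : R :=
  ((i + k <= j)%N)%:R * (2 * al (j - (i + k))) +
  ((i <= j < i + k)%N)%:R * (2 * al (distn (i + k) (j + l)) + 2 * al k).

Lemma sum_window (R' : numDomainType) N (i k : nat) :
  \sum_(j < N) ((i <= j < i + k)%N)%:R <= k%:R :> R'.
Proof.
rewrite -natr_sum ler_nat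
  -(big_mkord xpredT (fun j => nat_of_bool (i <= j < i + k)%N)).
rewrite -big_mkcond/= sum1_count -size_filter -[k in leqRHS](size_iota i k).
apply: uniq_leq_size; first exact/filter_uniq/iota_uniq.
by move=> j; rewrite mem_filter mem_iota => /andP[].
Qed.

(** For fixed [k] and [i], disjoint pairs contribute [2A] per [l]. Overlapping pairs have at most
    [k] values of [j], each costing [4A] once summed over [l], plus the product term. Summing over
    [k] and [i] gives [8 = 2 + 4 + 2]. *)
Lemma sum_cov_bound a N :
  \sum_(k < a.+1) \sum_(i < N) \sum_(l < a.+1) \sum_(j < N) cov_bound k i l j <=
  8 * A * a.+1%:R ^+ 2 * N%:R.
Proof.
have A0 : 0 <= A by have := al_sum 0; rewrite big_ord0.
have inner k i : (k < a.+1)%N ->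
    \sum_(l < a.+1) \sum_(j < N) cov_bound k i l j <=
    6 * A * a.+1%:R + 2 * a.+1%:R ^+ 2 * al k.
  move=> ka.
  have kaR : k%:R <= a.+1%:R :> R by rewrite ler_nat ltnW.
  have E1 : \sum_(l < a.+1) \sum_(j < N) ((i + k <= j)%N)%:R *
    (2 * al (j - (i + k))) <=
      2 * A * a.+1%:R.
    rewrite mulr_natr -[a.+1 in leRHS]card_ord -sumr_const;
      apply: ler_sum => l _.
    rewrite (eq_bigr (fun j : 'I_N => 2 *
      (((i + k <= j)%N)%:R * al (j - (i + k))))) => [|j _];
      last by rewrite mulrCA.
    rewrite -mulr_sumr ler_pM2l//.
    by apply: (@sum_inj_le _ (fun j => i + k <= j)%N (fun j => j - (i + k))%N)
      => x y /=; lia.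
  have E2 : \sum_(l < a.+1) \sum_(j < N) ((i <= j < i + k)%N)%:R *
    (2 * al (distn (i + k) (j + l))) <=
      4 * A * a.+1%:R.
    rewrite exchange_big/=.
    apply: (@le_trans _ _ (\sum_(j < N) ((i <= j < i + k)%N)%:R * (4 * A))).
      apply: ler_sum => j _; rewrite -mulr_sumr ler_wpM2l// -mulr_sumr.
      rewrite (_ : 4 * A = 2 * (2 * A)); last by rewrite mulrA -natrM.
      by rewrite ler_pM2l// sum_distn_le.
    rewrite -mulr_suml mulrC ler_wpM2l ?mulr_ge0//.
    exact: le_trans (sum_window _ _ _ _) kaR.
  (* The factor [al k] is kept for the later sum over [k]; bounding it by [A] here would leave a
     cube of [a.+1]. *)
  have E3 : \sum_(l < a.+1) \sum_(j < N) ((i <= j < i + k)%N)%:R * (2 * al k) <=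
      2 * a.+1%:R ^+ 2 * al k.
    rewrite (_ : 2 * _ * _ = a.+1%:R * (2 * al k) * a.+1%:R); last by ring.
    rewrite mulr_natr -[a.+1 in leRHS]card_ord -sumr_const card_ord;
      apply: ler_sum => l _.
    rewrite -mulr_suml ler_wpM2r ?mulr_ge0//.
    exact: le_trans (sum_window _ _ _ _) kaR.
  rewrite (_ : 6 * A * a.+1%:R + _ =
    2 * A * a.+1%:R + (4 * A * a.+1%:R + 2 * a.+1%:R ^+ 2 * al k));
    last by ring.
  apply: le_trans (lerD E1 (lerD E2 E3)); rewrite -!big_split/=.
  apply: ler_sum => l _; rewrite -!big_split/=; apply: ler_sum => j _.
  by rewrite /cov_bound mulrDr.
apply: (@le_trans _ _
  (\sum_(k < a.+1) (6 * A * a.+1%:R + 2 * a.+1%:R ^+ 2 * al k) * N%:R)).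
  apply: ler_sum => k _; rewrite mulr_natr -[N in leRHS]card_ord -sumr_const.
  by apply: ler_sum => i _; exact: inner.
rewrite -mulr_suml ler_wpM2r// big_split/= sumr_const card_ord -mulr_sumr.
rewrite (_ : 8 * A * _ = (6 * A * a.+1%:R) *+ a.+1 + 2 * a.+1%:R ^+ 2 * A);
  last by rewrite -[_ *+ a.+1]mulr_natr; ring.
rewrite lerD2l; apply: ler_wpM2l;
  [by rewrite mulr_ge0 ?exprn_ge0|exact: al_sum].
Qed.

End summable_bounds.

(** With an indicator the range no longer depends on [k], so sums over lag and time become sums over
    a rectangle. The ordinal [i] stands for time [i + 1]. *)
Lemma sum_lag (R : pzRingType) N k (F : nat -> R) :
  \sum_(i < N) ((i + k < N)%N)%:R * F i.+1 = \sum_(1 <= i < (N - k).+1) F i.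
Proof.
rewrite big_add1/= big_mkord (big_ord_widen _ (fun i => F i.+1) (leq_subr k N)).
rewrite [RHS]big_mkcond/=; apply: eq_bigr => i _.
have -> : (i + k < N)%N = (i < N - k)%N by lia.
by case: ifP; rewrite ?mul1r ?mul0r.
Qed.

Section second_moments.
Context d (T : measurableType d) (R : realType) (P : probability T R).
Local Notation E f := (Rintegral P setT f).
Variable X : int -> {RV P >-> R}.
Hypothesis statX : strictly_stationary X.
Variables (al : nat -> R) (A : R).
Hypothesis alX : forall k, (0 < k)%N -> (alpha2 X k <= (al k)%:E)%E.
Hypothesis al0 : al 0 = 1.
Hypothesis al_ge0 : forall k, 0 <= al k.
Hypothesis al_sum : forall N, \sum_(k < N) al k <= A.
Variable h : R -> R.
Hypothesis hm : mono01 h.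
Local Notation W := (centered_at X h).

Let bW k : bmeas (W k). Proof. exact: bmeas_centered_at. Qed.
Let W1 k w : `|W k w| <= 1. Proof. exact: centered_at_le1. Qed.

Lemma exp_sqr_sum (I : finType) (F : I -> T -> R) : (forall i, bmeas (F i)) ->
  E (fun w => (\sum_i F i w) ^+ 2) = \sum_i \sum_j E (fun w => F i w * F j w).
Proof.
move=> bF.
transitivity (E (fun w => \sum_i \sum_j F i w * F j w)).
  by apply: eq_exp => w; rewrite expr2 big_distrlr.
rewrite exp_sum; last by move=> i; apply: bmeas_sum => j; exact: bmeasM.
by apply: eq_bigr => i _; rewrite exp_sum// => j; exact: bmeasM.
Qed.

(** Each row of the covariance matrix sums to at most [4A]: a factor 2 from the covariance bound and
    a factor 2 because a distance occurs on both sides. *)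
Lemma mean_square_le N : (0 < N)%N ->
  E (fun w => (N%:R^-1 * \sum_(i < N) W i.+1 w) ^+ 2) <= 4 * A / N%:R.
Proof.
move=> N0; have N0R : 0 < N%:R :> R by rewrite ltr0n.
have bS : bmeas (fun w => (\sum_(i < N) W i.+1 w) ^+ 2) by apply: bmeasX;
  exact: bmeas_sum.
under eq_exp do rewrite exprMn.
rewrite expZl// exp_sqr_sum// expr2.
have -> : 4 * A / N%:R = N%:R^-1 / N%:R * (N%:R * (4 * A)).
  by field; rewrite gt_eqF.
apply: ler_wpM2l; first by rewrite mulr_ge0// invr_ge0 ltW.
rewrite mulr_natl -[N in leRHS]card_ord -sumr_const; apply: ler_sum => i _.
rewrite (_ : 4 * A = 2 * (2 * A)); last by rewrite mulrA -natrM.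
apply: (@le_trans _ _ (\sum_(j < N) 2 * al (distn i (0 + j)))); last first.
  by rewrite -mulr_sumr ler_pM2l// sum_distn_le.
apply: ler_sum => j _; rewrite add0n /distn.
have [ij|/ltnW ji] := leqP i j.
  rewrite (eqP ij) add0n -subSS; apply: le_trans (ler_norm _) _.
  exact: (moment2_le statX alX al0 hm).
rewrite (eqP ji) addn0 -subSS; apply: le_trans (ler_norm _) _.
under eq_exp do rewrite mulrC.
exact: (moment2_le statX alX al0 hm).
Qed.

Definition lag_dev (k i : nat) w :=
  W i.+1 w * W (i.+1 + k)%N w - E (fun w => W i.+1 w * W (i.+1 + k)%N w).

Lemma bmeas_lag_dev k i : bmeas (lag_dev k i).
Proof. by apply: bmeasB; [exact: bmeasM|exact: bmeas_cst]. Qed.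

Lemma exp_cov (U V : T -> R) : bmeas U -> bmeas V ->
  E (fun w => (U w - E U) * (V w - E V)) = E (fun w => U w * V w) - E U * E V.
Proof.
move=> bU bV; have bc (r : R) : bmeas (fun _ : T => r) := bmeas_cst _ r.
have bVc : bmeas (fun w => V w - E V) by exact: bmeasB.
rewrite exp_centerM//; last exact: bmeasB.
rewrite (_ : E (fun w => U w - E U) = 0) ?expB ?exp_cst ?subrr//.
rewrite -expZl// -expB//; [|exact: bmeasM|exact: bmeasM].
by apply: eq_exp => w; rewrite subr0 mulrBl.
Qed.

Lemma cov_bound_ge0 k i l j : 0 <= cov_bound al k i l j.
Proof. by rewrite addr_ge0// mulr_ge0// ?addr_ge0// mulr_ge0. Qed.

(** [cov_bound] is meant for [i <= j]; adding its mirror image makes the bound symmetric, which is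
    what permits the reduction to that order. *)
Lemma exp_lag_dev_le k i l j :
  `|E (fun w => lag_dev k i w * lag_dev l j w)| <=
  cov_bound al k i l j + cov_bound al l j k i.
Proof.
wlog ij : k i l j / (i <= j)%N => [H|].
  have [ij|/ltnW ji] := leqP i j; first exact: H.
  by rewrite addrC; under eq_exp do rewrite mulrC; exact: H.
apply: (@le_trans _ _ (cov_bound al k i l j));
  last by rewrite lerDl cov_bound_ge0.
rewrite exp_cov; [|exact: bmeasM..].
have WW1 (a b : int) : `|E (fun w => W a w * W b w)| <= 1.
  by apply: norm_exp_le; [exact: bmeasM|move=> w; exact: normM_le1].
rewrite /cov_bound; have [kj|jk] := leqP (i + k) j.
  rewrite andbF mul1r mul0r addr0 -subSS -addSn.
  by apply: (cov4_le statX alX al0 hm); lia.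
rewrite mul0r add0r ij andbT mul1r; apply: (le_trans (ler_normB _ _));
  rewrite lerD//.
  (* The pairs overlap, so both starting times precede both end times. The later end time is placed
     last, and the last gap is the distance between the end times. *)
  rewrite (eq_exp _ (g := fun w => W i.+1 w * W j.+1 w *
    (W (i.+1 + k)%N w * W (j.+1 + l)%N w))); last first.
    by move=> w; ring.
  rewrite /distn; have [le|/ltnW le] := leqP (i + k) (j + l).
    rewrite (eqP le) add0n -subSS -!addSn.
    by apply: (moment4_le statX alX al0 hm); lia.
  rewrite (eqP le) addn0 -subSS -!addSn.
  rewrite (eq_exp _ (g := fun w => W i.+1 w * W j.+1 w *
    (W (j.+1 + l)%N w * W (i.+1 + k)%N w))); last first.
    by move=> w; ring.
  by apply: (moment4_le statX alX al0 hm); lia.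
rewrite normrM -[leRHS]mulr1 ler_pM//.
by have := moment2_le statX alX al0 hm (leq_addr k i.+1); rewrite addKn.
Qed.

Definition lag_weight (k : nat) : R := if k == 0 then 1 else 2.

(** The estimator that would be available if [h] and the mean of [h (X 0)] were known. *)
Definition lrv_sum N a w := \sum_(k < a.+1) lag_weight k *
  (N%:R^-1 * \sum_(i < N) ((i + k < N)%N)%:R * (W i.+1 w * W (i.+1 + k)%N w)).

Lemma bmeas_lrv_sum N a : bmeas (lrv_sum N a).
Proof.
apply: bmeas_sum => k; apply: bmeasM; first exact: bmeas_cst.
apply: bmeasM; first exact: bmeas_cst.
apply: bmeas_sum => i; apply: bmeasM; first exact: bmeas_cst.
exact: bmeasM.
Qed.

(** At lag [k] there are [N - k] products with a common mean; the triangular weight [(N - k) / N] is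
    one of the two sources of bias. *)
Lemma exp_lrv_sum N a : E (lrv_sum N a) = \sum_(k < a.+1) lag_weight k *
  ((N - k)%:R / N%:R * E (fun w => W 0 w * W k w)).
Proof.
have bWW i k : bmeas (fun w => W i w * W k w) by exact: bmeasM.
have bi (N' i k : nat) : bmeas
  (fun w => ((i + k < N')%N)%:R * (W i.+1 w * W (i.+1 + k)%N w)).
  by apply: bmeasM => //; exact: bmeas_cst.
have bs (k : nat) : bmeas (fun w => \sum_(i < N) ((i + k < N)%N)%:R *
  (W i.+1 w * W (i.+1 + k)%N w)).
  by apply: bmeas_sum => i.
rewrite exp_sum; last first.
  by move=> k; apply: bmeasM;
    [exact: bmeas_cst|apply: bmeasM => //; exact: bmeas_cst].
apply: eq_bigr => k _; rewrite expZl; last by apply: bmeasM => //;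
  exact: bmeas_cst.
congr (_ * _); rewrite expZl// mulrC [RHS]mulrAC; congr (_ * _).
rewrite exp_sum//.
rewrite (eq_bigr
  (fun i : 'I_N => ((i + k < N)%N)%:R * E (fun w => W 0 w * W k w)));
  last first.
  move=> i _; rewrite expZl//; congr (_ * _).
  by rewrite (moment2_shift statX hm 0 k i.+1) add0r addrC.
rewrite -mulr_suml; congr (_ * _).
have := sum_lag N k (fun=> 1 : R); rewrite sumr_const_nat subSS subn0 => <-.
by apply: eq_bigr => i _; rewrite mulr1.
Qed.

(** The constant is [4 * 8 * 2]: two lag weights of at most 2, the constant of [sum_cov_bound], and
    the symmetrisation of [cov_bound]. *)
Lemma lrv_sum_variance N a : (0 < N)%N ->
  E (fun w => (lrv_sum N a w - E (lrv_sum N a)) ^+ 2) <=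
    64 * A * a.+1%:R ^+ 2 / N%:R.
Proof.
move=> N0; have N0R : 0 < N%:R :> R by rewrite ltr0n.
pose e (p : 'I_a.+1 * 'I_N) := lag_weight p.1 * ((p.2 + p.1 < N)%N)%:R.
have e02 p : 0 <= e p <= 2.
  by rewrite /e /lag_weight; case: eqP => _; case: (_ < _)%N => /=; apply/andP;
    split; lra.
pose F p w := N%:R^-1 * e p * lag_dev p.1 p.2 w.
have bF p : bmeas (F p) by apply: bmeasM;
  [exact: bmeas_cst|exact: bmeas_lag_dev].
have bWW (i k : int) : bmeas (fun w => W i w * W k w) by exact: bmeasM.
have SE w : lrv_sum N a w - E (lrv_sum N a) = \sum_p F p w.
  rewrite /lrv_sum exp_sum; last first.
    move=> k; apply: bmeasM; first exact: bmeas_cst.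
    apply: bmeasM; first exact: bmeas_cst.
    by apply: bmeas_sum => i; apply: bmeasM => //; exact: bmeas_cst.
  rewrite -sumrB -(pair_bigA _ (fun k i => F (k, i) w))/=;
    apply: eq_bigr => k _.
  have bi (i : 'I_N) : bmeas
    (fun w => ((i + k < N)%N)%:R * (W i.+1 w * W (i.+1 + k)%N w)).
    by apply: bmeasM => //; exact: bmeas_cst.
  have bs : bmeas (fun w => \sum_(i < N) ((i + k < N)%N)%:R *
    (W i.+1 w * W (i.+1 + k)%N w)).
    exact: bmeas_sum.
  rewrite expZl; last by apply: bmeasM => //; exact: bmeas_cst.
  rewrite expZl// exp_sum// -!mulrBr -sumrB !mulr_sumr; apply: eq_bigr => i _.
  by rewrite expZl// /F /e /lag_dev/=; ring.
under eq_exp do rewrite SE.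
rewrite exp_sqr_sum//.
pose b (p q : 'I_a.+1 * 'I_N) := cov_bound al p.1 p.2 q.1 q.2.
have b0 p q : 0 <= b p q by exact: cov_bound_ge0.
apply: (@le_trans _ _ (\sum_p \sum_q 4 * N%:R^-1 ^+ 2 * (b p q + b q p))).
  apply: ler_sum => p _; apply: ler_sum => q _.
  rewrite (eq_exp _ (g := fun w => N%:R^-1 ^+ 2 * (e p * e q) *
    (lag_dev p.1 p.2 w * lag_dev q.1 q.2 w))); last first.
    by move=> w; rewrite /F; ring.
  have bLL : bmeas (fun w => lag_dev p.1 p.2 w * lag_dev q.1 q.2 w).
    by apply: bmeasM; exact: bmeas_lag_dev.
  have c0 : 0 <= N%:R^-1 ^+ 2 :> R by rewrite exprn_ge0// invr_ge0 ltW.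
  rewrite expZl//; move: (N%:R^-1 ^+ 2 : R) c0 => c c0.
  rewrite (mulrC 4 c) -(mulrA c) -(mulrA c 4); apply: ler_wpM2l => //.
  apply: (le_trans (ler_norm _)); rewrite normrM.
  have /andP[ep0 ep2] := e02 p; have /andP[eq0 eq2] := e02 q.
  have ee0 : 0 <= e p * e q by rewrite mulr_ge0.
  have ee4 : e p * e q <= 4 by nra.
  by rewrite (ger0_norm ee0); apply: ler_pM => //; exact: exp_lag_dev_le.
under eq_bigr do rewrite -mulr_sumr big_split/=.
rewrite -mulr_sumr big_split/= [X in _ + X]exchange_big/= -mulr2n
  -[X in _ * X <= _]mulr_natr.
have -> : \sum_p \sum_q b p q =
  \sum_(k < a.+1) \sum_(i < N) \sum_(l < a.+1) \sum_(j < N) cov_bound al k i l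
  j.
  rewrite -(pair_bigA _ (fun k i => \sum_q b (k, i) q))/=.
  by do 2!(apply: eq_bigr => ? _);
    rewrite -(pair_bigA _ (fun l j => b (_, _) (l, j))).
have -> : 64 * A * a.+1%:R ^+ 2 / N%:R =
  4 * N%:R^-1 ^+ 2 * ((8 * A * a.+1%:R ^+ 2 * N%:R) * 2).
  by field; rewrite gt_eqF.
apply: ler_wpM2l; first by rewrite mulr_ge0// exprn_ge0// invr_ge0 ltW.
by apply: ler_wpM2r => //; exact: sum_cov_bound.
Qed.

End second_moments.

(** * Estimators built on an empirical kernel *)

Section deterministic.
Variable R : realType.
Implicit Types x y u : nat -> R.

Definition lag_cross (N : nat) x (k : nat) : R :=
  N%:R^-1 * \sum_(1 <= i < (N - k).+1) x i * x (i + k)%N.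

Lemma lag_sumE (F : nat -> R) a :
  F 0 + 2 * \sum_(1 <= k < a.+1) F k = \sum_(k < a.+1) lag_weight R k * F k.
Proof.
rewrite big_ord_recl /lag_weight/= mul1r; congr (_ + _).
by rewrite big_add1/= big_mkord mulr_sumr; apply: eq_bigr.
Qed.

Lemma emp_long_run_varE N u a : emp_long_run_var N u a =
  \sum_(k < a.+1) lag_weight R k * lag_cross N (fun i => u i - emp_mean N u) k.
Proof. exact: (lag_sumE (fun k => lag_cross N (fun i => u i - emp_mean N u) k)).
  Qed.

Lemma ler_sum_sub (F : nat -> R) M N k : (forall i, 0 <= F i) ->
  (M + k <= N)%N ->
  \sum_(1 <= i < M.+1) F (i + k)%N <= \sum_(1 <= i < N.+1) F i.
Proof.
move=> F0 MN.
rewrite -{1}[M.+1](addnK k) -(big_addn 1%N (M.+1 + k) k xpredT F).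
rewrite (@big_cat_nat _ _ _ (1 + k)%N 1%N N.+1)//=; [|lia..].
rewrite (@big_cat_nat _ _ _ (M.+1 + k)%N (1 + k)%N N.+1)//=; [|lia..].
by rewrite addrCA lerDl addr_ge0// sumr_ge0.
Qed.

(** A difference of products changes one factor at a time; each of the two resulting sums runs over
    a window inside [1..N]. *)
Lemma lag_cross_diff N x y k : (0 < N)%N ->
  (forall i, `|x i| <= 1) -> (forall i, `|y i| <= 1) ->
  `|lag_cross N x k - lag_cross N y k| <=
    2 * emp_mean N (fun i => `|x i - y i|).
Proof.
move=> N0 x1 y1; have N0R : 0 < N%:R :> R by rewrite ltr0n.
have s0 : 0 <= \sum_(1 <= i < N.+1) `|x i - y i| by apply: sumr_ge0.
rewrite /lag_cross -mulrBr -sumrB normrM gtr0_norm ?invr_gt0//.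
rewrite /emp_mean mulrCA ler_pM2l ?invr_gt0// (mulrDl 1 1) mul1r.
have [kN|Nk] := leqP k N; last first.
  by rewrite (eqP (ltnW Nk)) big_nil normr0 addr_ge0.
have F0 i : 0 <= `|x i - y i| by [].
apply: (@le_trans _ _ (\sum_(1 <= i < (N - k).+1)
  (`|x i - y i| + `|x (i + k)%N - y (i + k)%N|))); last first.
  rewrite big_split lerD//.
    by have := @ler_sum_sub _ (N - k) N 0 F0;
      rewrite addn0 => /(_ (leq_subr _ _));
      rewrite (eq_bigr (fun i => `|x i - y i|)) // => i _; rewrite addn0.
  by apply: (@ler_sum_sub _ (N - k) N k F0); rewrite subnK.
apply: (le_trans (ler_norm_sum _ _ _)); apply: ler_sum => i _.
have -> : x i * x (i + k)%N - y i * y (i + k)%N =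
  (x i - y i) * x (i + k)%N + y i * (x (i + k)%N - y (i + k)%N) by ring.
apply: (le_trans (ler_normD _ _)); rewrite !normrM lerD//.
  by rewrite ler_piMr.
by rewrite ler_piMl.
Qed.

Lemma lag_weight_ge0 k : 0 <= lag_weight R k.
Proof. by rewrite /lag_weight; case: eqP. Qed.

Lemma lag_weight_le2 k : lag_weight R k <= 2.
Proof. by rewrite /lag_weight; case: eqP => // _; rewrite ler1n. Qed.

(** No cancellation between lags is used. The loss of a factor [a.+1] is affordable because its
    square is compared with [N]. *)
Lemma lag_sum_diff N x y a : (0 < N)%N ->
  (forall i, `|x i| <= 1) -> (forall i, `|y i| <= 1) ->
  `|\sum_(k < a.+1) lag_weight R k * lag_cross N x k -
    \sum_(k < a.+1) lag_weight R k * lag_cross N y k| <=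
  4 * a.+1%:R * emp_mean N (fun i => `|x i - y i|).
Proof.
move=> N0 x1 y1; rewrite -sumrB; apply: (le_trans (ler_norm_sum _ _ _)).
rewrite mulrAC mulr_natr -[a.+1 in leRHS]card_ord -sumr_const;
  apply: ler_sum => k _.
rewrite -mulrBr normrM (ger0_norm (lag_weight_ge0 _)).
have -> : 4 * emp_mean N (fun i => `|x i - y i|) =
  2 * (2 * emp_mean N (fun i => `|x i - y i|)).
  by rewrite mulrA -natrM.
by rewrite ler_pM// ?lag_weight_ge0 ?lag_weight_le2// lag_cross_diff.
Qed.

(** The difference of the two sides is an empirical variance. *)
Lemma sqr_mean_le N (u : nat -> R) : (0 < N)%N ->
  emp_mean N u ^+ 2 <= emp_mean N (fun i => u i ^+ 2).
Proof.
move=> N0; have N0R : 0 < N%:R :> R by rewrite ltr0n.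
set e := emp_mean N u.
have : 0 <= emp_mean N (fun i => (u i - e) ^+ 2).
  by rewrite /emp_mean mulr_ge0 ?invr_ge0// sumr_ge0// => i _; exact: sqr_ge0.
have -> : emp_mean N (fun i => (u i - e) ^+ 2) =
  emp_mean N (fun i => u i ^+ 2) - e ^+ 2.
  have -> : emp_mean N (fun i => (u i - e) ^+ 2) =
      emp_mean N (fun i => u i ^+ 2) - 2 * e * emp_mean N u + e ^+ 2.
    rewrite /emp_mean (eq_bigr (fun i => u i ^+ 2 - 2 * e * u i + e ^+ 2));
      last by move=> i _; ring.
    rewrite big_split/= sumrB -mulr_sumr sumr_const_nat subSS subn0 -mulr_natr.
    by field; rewrite gt_eqF.
  by rewrite -/e; ring.
by rewrite subr_ge0.
Qed.

Lemma emp_mean_le N (u v : nat -> R) :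
  (forall i, u i <= v i) -> emp_mean N u <= emp_mean N v.
Proof. by move=> uv; rewrite ler_wpM2l ?invr_ge0// ler_sum. Qed.

Lemma emp_meanD N (u v : nat -> R) : emp_mean N (fun i => u i + v i) =
  emp_mean N u + emp_mean N v.
Proof. by rewrite /emp_mean big_split/= mulrDr. Qed.

Lemma emp_mean_cst N (c : R) : (0 < N)%N -> emp_mean N (fun=> c) = c.
Proof.
move=> N0; rewrite /emp_mean sumr_const_nat subSS subn0 -[c *+ N]mulr_natl
  mulKf//.
by rewrite gt_eqF// ltr0n.
Qed.

Lemma emp_mean01 N (u : nat -> R) : (0 < N)%N -> (forall i, 0 <= u i <= 1) ->
  0 <= emp_mean N u <= 1.
Proof.
move=> N0 u01; have := @emp_mean_le N _ _ (fun i => (andP (u01 i)).1).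
have := @emp_mean_le N _ _ (fun i => (andP (u01 i)).2).
by rewrite !emp_mean_cst// => -> ->.
Qed.

Lemma emp_mean_norm N (u : nat -> R) : `|emp_mean N u| <=
  emp_mean N (fun i => `|u i|).
Proof. by rewrite normrM ger0_norm ?invr_ge0// ler_wpM2l ?invr_ge0//
  ler_norm_sum. Qed.

End deterministic.

(** * Freezing one of two independent variables *)

Section fubini.
Context d (T : measurableType d) (R : realType) (P : probability T R).
Local Notation E f := (Rintegral P setT f).

(** Agreement on rectangles identifies the law of [(U, V)] with the product law; Tonelli then
    integrates over [V] with [U] frozen. *)
Lemma indep_exp_le d1 d2 (T1 : measurableType d1) (T2 : measurableType d2)
    (U : {mfun T >-> T1}) (V : {mfun T >-> T2}) (G : T1 -> T2 -> R) c :
  (forall A B, measurable A -> measurable B ->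
    P (U @^-1` A `&` V @^-1` B) = (P (U @^-1` A) * P (V @^-1` B))%E) ->
  bmeas (fun z : T1 * T2 => G z.1 z.2) -> (forall x y, 0 <= G x y) ->
  (forall x, E (fun w => G x (V w)) <= c) -> E (fun w => G (U w) (V w)) <= c.
Proof.
move=> indep bG G0 Gc.
pose UV w := (U w, V w).
have mUV : measurable_fun setT UV by exact: measurable_fun_pair.
pose UVm : {mfun T >-> (T1 * T2)%type} := HB.pack UV
  (@isMeasurableFun.Build _ _ _ _ UV mUV).
have bGUV : bmeas (fun w => G (U w) (V w)) by exact: (bmeas_comp mUV bG).
have bGV x : bmeas (fun w => G x (V w)).
  apply: (bmeas_comp (f := fun w => (x, V w)) _ bG).
  exact: measurable_fun_pair.
have mG : measurable_fun setT (fun z : T1 * T2 => (G z.1 z.2)%:E).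
  by apply/measurable_EFinP; exact: bG.1.
rewrite -lee_fin -EFin_exp//.
have -> : (\int[P]_w (G (U w) (V w))%:E =
  \int[distribution P UVm]_z (G z.1 z.2)%:E)%E.
  by rewrite ge0_integral_distribution// => z; rewrite lee_fin.
have -> : (\int[distribution P UVm]_z (G z.1 z.2)%:E =
    \int[distribution P U \x distribution P V]_z (G z.1 z.2)%:E)%E.
  apply: eq_measure_integral => A mA _; apply/esym.
  apply: (product_measure_unique (m1 := distribution P U)
    (m2 := distribution P V) _ mA).
  move=> A1 A2 mA1 mA2.
  by have := indep A1 A2 mA1 mA2; rewrite /distribution/pushforward/=.
rewrite fubini_tonelli1//=; last by move=> z; rewrite lee_fin.
have -> : c%:E = (\int[distribution P U]_x (cst c%:E) x)%E.
  rewrite integral_cst// (_ : _ setT = 1%E) ?mule1//.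
  exact: (probability_setT (distribution P U)).
apply: ge0_le_integral => //.
- by move=> x _; apply: integral_ge0 => y _; rewrite lee_fin.
- by apply: measurable_fun_fubini_tonelli_F => // z; rewrite lee_fin.
- move=> x _; apply: (@le_trans _ _ (E (fun w => G x (V w)))%:E);
  last by rewrite lee_fin.
  rewrite -EFin_exp// /fubini_F/= ge0_integral_distribution//.
    apply/measurable_EFinP; apply: (bmeas_comp (f := fun y => (x, y)) _ bG).1.
    exact: measurable_fun_pair.
  by move=> y; rewrite lee_fin.
Qed.

End fubini.

Section plug_in.
Context d (T : measurableType d) (R : realType) (P : probability T R).
Local Notation E f := (Rintegral P setT f).
Variables X Y : int -> {RV P >-> R}.
Hypotheses (statX : strictly_stationary X) (statY : strictly_stationary Y).
Hypothesis indXY : independent_processes X Y.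
Variables (al be : nat -> R) (A B : R).
Hypothesis alX : forall k, (0 < k)%N -> (alpha2 X k <= (al k)%:E)%E.
Hypothesis al0 : al 0 = 1.
Hypothesis al_ge0 : forall k, 0 <= al k.
Hypothesis al_sum : forall N, \sum_(k < N) al k <= A.
Hypothesis beY : forall k, (0 < k)%N -> (alpha2 Y k <= (be k)%:E)%E.
Hypothesis be0 : be 0 = 1.
Hypothesis be_ge0 : forall k, 0 <= be k.
Hypothesis be_sum : forall N, \sum_(k < N) be k <= B.
Variables (q : R -> R -> R) (h : R -> R).
Hypothesis qm : forall t, mono01 (q t).
Hypothesis mq : measurable_fun setT (fun z : R * R => q z.1 z.2).
Hypothesis hE : forall t, h t = E (fun w => q t (Y 0 w)).
Hypothesis hm : mono01 h.
Local Notation W := (centered_at X h).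

Definition plug m w t := emp_mean m (fun j => q t (Y j w)).

(** Events of the block [(Y_1, ..., Y_m)] lie in the sigma-algebra of the process [Y], since the
    block is measurable coordinate by coordinate. *)
Lemma indep_past (m : nat) (i : int) : 
  forall C D, measurable C -> measurable D ->
    P (X i @^-1` C `&` (fun w => [tuple Y l.+1 w | l < m]) @^-1` D) =
    (P (X i @^-1` C) * P ((fun w => [tuple Y l.+1 w | l < m]) @^-1` D))%E.
Proof.
move=> C D mC mD; apply: indXY.
  by apply: sub_sigma_algebra; exists i => //; exists C => //; rewrite setTI.
pose gens := \bigcup_(i in [set: int]) preimage_set_system setT (Y i)
  measurable.
have : measurable_fun setT ((fun w => [tuple Y l.+1 w | l < m]) :
  g_sigma_algebraType gens -> m.-tuple R).
  apply/measurable_fun_tnthP => l _ S mS.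
  apply: sub_sigma_algebra; exists l.+1 => //; exists S => //.
  by congr (_ `&` _); apply/seteqP; split => w /=; rewrite tnth_mktuple.
by move=> /(_ measurableT D mD); rewrite setTI.
Qed.

Lemma q_norm t y : `|q t y| <= 1.
Proof. by have /andP[? ?] := (qm t).2 y; rewrite ger0_norm. Qed.

Lemma bmeas_q : bmeas (fun z : R * R => q z.1 z.2).
Proof. by apply: bmeas_le1 => // z; exact: q_norm. Qed.

Lemma bmeas_plug m i : bmeas (fun w => plug m w (X i w)).
Proof.
apply: bmeasM; first exact: bmeas_cst.
apply: bmeas_sum => j;
  apply: (bmeas_comp (f := fun w => (X i w, Y j w)) _ bmeas_q).
exact: measurable_fun_pair.
Qed.

(** For frozen [x] the constant depends on [q x] only through its monotonicity, so the bound is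
    uniform in [x]. No control of the supremum over [x] inside the expectation is required. *)
Lemma plug_error m i : (0 < m)%N ->
  E (fun w => (plug m w (X i w) - h (X i w)) ^+ 2) <= 4 * B / m%:R.
Proof.
move=> m0; have m0R : 0 < m%:R :> R by rewrite ltr0n.
pose V w := [tuple Y l.+1 w | l < m].
have mV : measurable_fun setT V.
  apply/measurable_fun_tnthP => l.
  rewrite (_ : _ \o _ = Y l.+1) //.
  by apply/funext => w; rewrite /= tnth_mktuple.
pose Vm : {mfun T >-> m.-tuple R} := HB.pack V
  (@isMeasurableFun.Build _ _ _ _ V mV).
pose G x (v : m.-tuple R) := (m%:R^-1 * \sum_(l < m) q x (tnth v l) - h x) ^+ 2.
rewrite (eq_exp _ (g := fun w => G (X i w) (Vm w))); last first.
  move=> w; rewrite /G /plug /emp_mean big_add1/= big_mkord;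
    congr ((_ * _ - _) ^+ 2).
  by apply: eq_bigr => l _; rewrite /V tnth_mktuple.
apply: indep_exp_le.
- exact: indep_past.
- apply: bmeasX; apply: bmeasB.
    apply: bmeasM; first exact: bmeas_cst.
    apply: bmeas_sum => l.
    apply: (bmeas_comp (f := fun z : R * m.-tuple R => (z.1, tnth z.2 l)) _
      bmeas_q).
    apply: measurable_fun_pair => //=.
    by apply: (measurableT_comp (measurable_tnth l)).
  by apply: (bmeas_comp (f := fst) _ (mono01_bmeas_id hm)).
- by move=> x v; exact: sqr_ge0.
- move=> x; apply: le_trans
  (mean_square_le statY beY be0 be_ge0 be_sum (qm x) m0).
  rewrite le_eqVlt; apply/orP; left; apply/eqP; apply: eq_exp => w.
  have -> : \sum_(l < m) centered_at Y (q x) l.+1 w =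
    \sum_(l < m) q x (tnth (V w) l) - m%:R * h x.
    rewrite /centered_at sumrB sumr_const card_ord -hE mulr_natl; congr (_ - _).
    by apply: eq_bigr => l _; rewrite /V tnth_mktuple.
  by rewrite /G mulrBr mulKf ?gt_eqF.
Qed.

Definition emp_plug N m a w := emp_long_run_var N (fun i => plug m w (X i w)) a.

Lemma bmeas_emp_plug N m a : bmeas (emp_plug N m a).
Proof.
have bp i : bmeas
  (fun w => plug m w (X (i : nat) w) - emp_mean N (fun i => plug m w (X i w))).
  apply: bmeasB; first exact: bmeas_plug.
  apply: bmeasM; first exact: bmeas_cst.
  by apply: bmeas_sum => j; exact: bmeas_plug.
rewrite /emp_plug; under eq_fun do rewrite emp_long_run_varE.
apply: bmeas_sum => k; apply: bmeasM; first exact: bmeas_cst.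
apply: bmeasM; first exact: bmeas_cst.
by apply: bmeas_sum => i; apply: bmeasM; exact: bp.
Qed.

Lemma lrv_sumE N a w : lrv_sum X h N a w =
  \sum_(k < a.+1) lag_weight R k * lag_cross N (fun i => W i w) k.
Proof.
apply: eq_bigr => k _; congr (_ * (_ * _)).
by rewrite -(sum_lag N k (fun i => W i w * W (i + k)%N w)).
Qed.

(** With [D] the plug-in error, the two centred sequences differ by [D i - mean D - mean W], whose
    mean absolute value is at most [2 MD + |Wb|]. Then [16] is the square of the [4] in
    [lag_sum_diff], and [8] and [2] come from [(p + q)^2 <= 2 p^2 + 2 q^2] with [p = 2 MD]. *)
Lemma emp_plug_dist N m a w : (0 < N)%N -> (0 < m)%N ->
  (emp_plug N m a w - lrv_sum X h N a w) ^+ 2 <= 16 * a.+1%:R ^+ 2 *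
   (8 * emp_mean N (fun i => (plug m w (X i w) - h (X i w)) ^+ 2) +
    2 * (N%:R^-1 * \sum_(i < N) W i.+1 w) ^+ 2).
Proof.
move=> N0 m0.
pose u i := plug m w (X (i : nat) w); pose D (i : nat) := u i - h (X i w).
pose Wb := emp_mean N (fun i => W i w).
have u01 i : 0 <= u i <= 1 by apply: emp_mean01 => // j; exact: (qm _).2.
have x1 i : `|u i - emp_mean N u| <= 1.
  have := u01 i; have := emp_mean01 N0 u01; rewrite ler_norml.
  by move=> /andP[? ?] /andP[? ?]; apply/andP; split; lra.
have y1 (i : nat) : `|W i w| <= 1 by exact: centered_at_le1.
have dd := @lag_sum_diff _ N _ _ a N0 x1 y1.
rewrite -emp_long_run_varE -lrv_sumE -/(emp_plug N m a w) in dd.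
set MD := emp_mean N (fun i => `|D i|).
have eD : emp_mean N D = emp_mean N u - (Wb + E (fun w => h (X 0 w))).
  rewrite -(emp_mean_cst (E (fun w => h (X 0 w))) N0) -emp_meanD -mulN1r.
  have -> : -1 * emp_mean N (fun i => W i w + E (fun w => h (X 0 w))) =
      emp_mean N (fun i => - (W i w + E (fun w => h (X 0 w)))).
    by rewrite /emp_mean sumrN mulrN mulN1r.
  by rewrite -emp_meanD; congr emp_mean; apply/funext => i;
    rewrite /D /centered_at subrK.
have mxy : emp_mean N (fun i => `|u i - emp_mean N u - W i w|) <=
  2 * MD + `|Wb|.
  apply: (@le_trans _ _ (emp_mean N (fun i => `|D i| + (MD + `|Wb|))));
    last first.
    by rewrite emp_meanD emp_mean_cst// -/MD addrA mulrDl mul1r.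
  apply: emp_mean_le => i.
  have -> : u i - emp_mean N u - W i w = D i - emp_mean N D - Wb.
    by rewrite eD /D /centered_at; ring.
  rewrite addrA (le_trans (ler_normB _ _))// lerD2r (le_trans (ler_normB _ _))//
    lerD2l.
  exact: emp_mean_norm.
have MD0 : 0 <= MD by rewrite mulr_ge0 ?invr_ge0// sumr_ge0.
have MD2 : MD ^+ 2 <= emp_mean N (fun i => D i ^+ 2).
  apply: (le_trans (sqr_mean_le _ N0)); apply: emp_mean_le => i.
  by rewrite real_normK// num_real.
have -> : N%:R^-1 * \sum_(i < N) W i.+1 w =
  Wb by rewrite /Wb /emp_mean big_add1/= big_mkord.
have {}dd := le_trans dd (ler_wpM2l (mulr_ge0 (ler0n R 4) (ler0n R a.+1)) mxy).
rewrite -real_normK ?num_real//.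
apply: (@le_trans _ _ ((4 * a.+1%:R * (2 * MD + `|Wb|)) ^+ 2)).
  by rewrite ler_sqr ?nnegrE // (le_trans _ dd).
rewrite exprMn (_ : (4 * _) ^+ 2 = 16 * a.+1%:R ^+ 2);
  last by rewrite exprMn -natrX.
apply: ler_wpM2l; first by rewrite mulr_ge0// exprn_ge0.
have Wb2 : `|Wb| ^+ 2 = Wb ^+ 2 by rewrite real_normK// num_real.
rewrite -Wb2; apply: (@le_trans _ _ (8 * MD ^+ 2 + 2 * `|Wb| ^+ 2)).
  have := sqr_ge0 (2 * MD - `|Wb|); lra.
by rewrite lerD2r ler_pM2l.
Qed.

Lemma emp_plug_mse N m a : (0 < N)%N -> (0 < m)%N ->
  E (fun w => (emp_plug N m a w - lrv_sum X h N a w) ^+ 2) <=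
  128 * a.+1%:R ^+ 2 * (4 * B / m%:R + A / N%:R).
Proof.
move=> N0 m0.
have bc (r : R) : bmeas (fun _ : T => r) := bmeas_cst _ r.
have bD i : bmeas (fun w => (plug m w (X (i : nat) w) - h (X i w)) ^+ 2).
  by apply: bmeasX; apply: bmeasB;
    [exact: bmeas_plug|exact: (bmeas_mono01_process X hm)].
have bW i : bmeas (W i) by exact: bmeas_centered_at.
have bMD : bmeas
  (fun w => emp_mean N (fun i => (plug m w (X i w) - h (X i w)) ^+ 2)).
  by apply: bmeasM => //; apply: bmeas_sum.
have bMW : bmeas (fun w => (N%:R^-1 * \sum_(i < N) W i.+1 w) ^+ 2).
  by apply: bmeasX; apply: bmeasM => //; apply: bmeas_sum.
apply: (@le_trans _ _ (E (fun w => 16 * a.+1%:R ^+ 2 *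
   (8 * emp_mean N (fun i => (plug m w (X i w) - h (X i w)) ^+ 2) +
    2 * (N%:R^-1 * \sum_(i < N) W i.+1 w) ^+ 2)))).
  apply: le_exp => [||w]; last exact: emp_plug_dist.
    by apply: bmeasX; apply: bmeasB;
      [exact: bmeas_emp_plug|exact: bmeas_lrv_sum].
  by apply: bmeasM => //; apply: bmeasD; exact: bmeasM.
rewrite expZl; last by apply: bmeasD; exact: bmeasM.
have -> : 128 * a.+1%:R ^+ 2 * (4 * B / m%:R + A / N%:R) = 16 * a.+1%:R ^+ 2 *
  (8 * (4 * B / m%:R) + 2 * (4 * A / N%:R)) by ring.
apply: ler_wpM2l; first by rewrite mulr_ge0// exprn_ge0.
rewrite expD; [|exact: bmeasM|exact: bmeasM].
rewrite (expZl P 8 bMD) (expZl P 2 bMW) lerD ?ler_pM2l//;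
  last exact: (mean_square_le statX alX al0 al_ge0 al_sum hm).
rewrite /emp_mean expZl; last exact: bmeas_sum.
rewrite exp_sum// -(emp_mean_cst (4 * B / m%:R) N0); apply: emp_mean_le => i.
exact: plug_error.
Qed.

Definition lag_cov k := E (fun w => W 0 w * W (k : nat) w).

(** The covariance centres each factor at its own mean; stationarity makes this the common mean used
    in [W]. *)
Lemma cov_lagE k : cov_lag P (fun i => h \o X i) k = lag_cov k.
Proof.
rewrite /cov_lag covariance.unlock !expectation.unlock; congr fine.
apply: eq_integral => w _ /=; congr EFin.
by rewrite !(centered_atE statX hm).
Qed.

Lemma long_run_varE : long_run_var P (fun i => h \o X i) =
  lag_cov 0 + 2 * limn (fun n => \sum_(1 <= k < n) lag_cov k).
Proof.
rewrite /long_run_var -cov_lagE; congr (_ + _ * _).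
rewrite (_ : (fun n => \sum_(1 <= k < n) cov_lag P (fun i => h \o X i) k) =
  (fun n => \sum_(1 <= k < n) lag_cov k))//.
by apply/funext => n; apply: eq_bigr => k _; exact: cov_lagE.
Qed.

Lemma lag_cov_norm_le k : `|lag_cov k| <= 2 * al k.
Proof. by have := moment2_le statX alX al0 hm (leq0n k); rewrite subn0. Qed.

Lemma sum_al_le N M : \sum_(M <= k < N) al k <= A.
Proof.
apply: le_trans (al_sum N); rewrite -(big_mkord xpredT al).
have [MN|/ltnW NM] := leqP M N; last by rewrite [leLHS]big_geq//;
  exact: sumr_ge0.
by rewrite (@big_cat_nat _ _ _ M 0%N N)//= lerDr sumr_ge0.
Qed.

Lemma cvg_lag_cov : cvgn (fun n => \sum_(1 <= k < n) lag_cov k).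
Proof.
(* The value 0 at index 0 turns a sum starting at 1 into a [series]. *)
pose u k := if k == 0%N then 0 else lag_cov k.
have ule k : `|u k| <= 2 * al k.
  by rewrite /u; case: eqP => [->|_];
    [rewrite normr0 mulr_ge0|exact: lag_cov_norm_le].
have -> : (fun n => \sum_(1 <= k < n) lag_cov k) = series u.
  apply/funext => -[|n]; first by rewrite /series/= !big_geq.
  rewrite /series/= [RHS]big_ltn//= add0r; apply: eq_big_nat => k /andP[k1 _].
  by rewrite /u gtn_eqF.
apply: normed_cvg; apply: nondecreasing_is_cvgn.
  apply/nondecreasing_seqP => n; rewrite /normed_series_of /series/=.
  by rewrite big_nat_recr//= lerDl.
exists (2 * A) => _ [n _ <-]; rewrite /series/=.
apply: (@le_trans _ _ (\sum_(0 <= k < n) 2 * al k)); first exact: ler_sum.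
by rewrite -mulr_sumr ler_pM2l// sum_al_le.
Qed.

(** The first term comes from the triangular weights, each within [a / N] of 1; the second is the
    tail of the covariance series beyond lag [a]. *)
Lemma lrv_sum_bias N a : (0 < N)%N ->
  `|E (lrv_sum X h N a) - long_run_var P (fun i => h \o X i)| <=
  4 * A * a%:R / N%:R +
  2 * `|\sum_(1 <= k < a.+1) lag_cov k - limn
    (fun n => \sum_(1 <= k < n) lag_cov k)|.
Proof.
move=> N0; have N0R : 0 < N%:R :> R by rewrite ltr0n.
rewrite exp_lrv_sum// long_run_varE.
rewrite -(lag_sumE (fun k => (N - k)%:R / N%:R * lag_cov k)) subn0 divff
  ?gt_eqF// mul1r.
set L := limn _; set r := \sum_(1 <= k < a.+1) lag_cov k.
have -> : forall x, lag_cov 0 + 2 * x - (lag_cov 0 + 2 * L) =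
  2 * (x - r) + 2 * (r - L).
  by move=> x; ring.
apply: (le_trans (ler_normD _ _)); rewrite lerD//;
  last by rewrite normrM ger0_norm.
rewrite normrM ger0_norm// -sumrB.
have -> : 4 * A * a%:R / N%:R = 2 * (a%:R / N%:R * (2 * A)) by ring.
rewrite ler_pM2l//; apply: (le_trans (ler_norm_sum _ _ _)).
apply: (@le_trans _ _ (\sum_(1 <= k < a.+1) a%:R / N%:R * (2 * al k)));
  last first.
  rewrite -!mulr_sumr ler_wpM2l ?divr_ge0 ?ler0n // ler_pM2l//.
  exact: sum_al_le.
rewrite big_nat [leRHS]big_nat; apply: ler_sum => k /andP[k1 ka].
rewrite -[X in _ - X]mul1r -mulrBl normrM ler_pM// ?lag_cov_norm_le//.
rewrite distrC ger0_norm; last first.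
  by rewrite subr_ge0 ler_pdivrMr// mul1r ler_nat leq_subr.
rewrite lerBlDr -mulrDl ler_pdivlMr// mul1r -natrD ler_nat; lia.
Qed.

Lemma emp_plug_lrv_mse N m a : (0 < N)%N -> (0 < m)%N ->
  E (fun w => (emp_plug N m a w - long_run_var P (fun i => h \o X i)) ^+ 2) <=
  3 * (128 * a.+1%:R ^+ 2 * (4 * B / m%:R + A / N%:R) + 64 * A *
    a.+1%:R ^+ 2 / N%:R +
    (4 * A * a%:R / N%:R +
     2 * `|\sum_(1 <= k < a.+1) lag_cov k - limn
       (fun n => \sum_(1 <= k < n) lag_cov k)|) ^+ 2).
Proof.
move=> N0 m0; set V := long_run_var _ _.
have bc (r : R) : bmeas (fun _ : T => r) := bmeas_cst _ r.
have bE := bmeas_emp_plug N m a;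
  have bS : bmeas (lrv_sum X h N a) by exact: bmeas_lrv_sum.
have b1 : bmeas (fun w => (emp_plug N m a w - lrv_sum X h N a w) ^+ 2) by apply:
  bmeasX; exact: bmeasB.
have b2 : bmeas (fun w => (lrv_sum X h N a w - E (lrv_sum X h N a)) ^+ 2) by
  apply: bmeasX; exact: bmeasB.
apply: (@le_trans _ _
  (E (fun w => 3 * ((emp_plug N m a w - lrv_sum X h N a w) ^+ 2 +
    (lrv_sum X h N a w - E (lrv_sum X h N a)) ^+ 2 +
      (E (lrv_sum X h N a) - V) ^+ 2)))).
  apply: le_exp => [||w]; [by apply: bmeasX;
    exact: bmeasB|by apply: bmeasM => //; apply: bmeasD => //; exact: bmeasD|].
  move: (emp_plug _ _ _ _) (lrv_sum _ _ _ _ _) (E _) => x y z.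
  (* [3 (p^2 + q^2 + r^2) - (p + q + r)^2] is the sum of the squared pairwise differences. *)
  have := sqr_ge0 ((x - y) - (y - z)); have := sqr_ge0 ((x - y) - (z - V)).
  by have := sqr_ge0 ((y - z) - (z - V)); nra.
rewrite expZl; last by apply: bmeasD => //; exact: bmeasD.
rewrite expD//; last exact: bmeasD.
rewrite expD// exp_cst ler_pM2l// lerD//; last first.
  rewrite -real_normK ?num_real// ler_sqr ?nnegrE//; first exact: lrv_sum_bias.
  by rewrite (le_trans _ (lrv_sum_bias a N0)).
rewrite lerD//; first exact: emp_plug_mse.
exact: (lrv_sum_variance statX alX al0 al_ge0 al_sum hm).
Qed.

End plug_in.

(** * Convergence *)

Section summable_mixing.
Context d (T : measurableType d) (R : realType) (P : probability T R).
Variable X : int -> {RV P >-> R}.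

Lemma alpha2_ge0 k : (0 <= alpha2 X k)%E.
Proof.
rewrite /alpha2 le_max; apply/orP; left.
apply: (@le_trans _ _ (L1_dev X (fun w => (X k w <= 0)%R%:R) (F_of X 0))).
  exact: Lnorm_ge0.
by apply: ereal_sup_ubound; exists 0.
Qed.

(** Finiteness of the sum makes every coefficient of positive index finite. The value 1 at index 0
    accounts for the [1 +] in [A]. *)
Lemma summable_alpha2 : (\sum_(1 <= k <oo) alpha2 X k < +oo)%E ->
  exists (al : nat -> R) (A : R),
    [/\ forall k, (0 < k)%N -> (alpha2 X k <= (al k)%:E)%E, al 0 = 1,
        forall k, 0 <= al k & forall N, \sum_(k < N) al k <= A].
Proof.
set S := (\sum_(_ <= _ <oo) _)%E => Soo.
have S0 : (0 <= S)%E by apply: nneseries_ge0 => k _ _; exact: alpha2_ge0.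
have psum n : (\sum_(1 <= k < n) alpha2 X k <= S)%E.
  by apply: nneseries_lim_ge => k _ _; exact: alpha2_ge0.
have fin k : (0 < k)%N -> alpha2 X k \is a fin_num.
  move=> k0; rewrite ge0_fin_numE ?alpha2_ge0//; apply: le_lt_trans Soo.
  apply: le_trans (psum k.+1); rewrite big_nat_recr//= leeDr//.
  by apply: sume_ge0 => i _; exact: alpha2_ge0.
exists (fun k => if k == 0%N then 1 else fine (alpha2 X k)), (1 + fine S);
  split => //.
- by move=> k k0; rewrite gtn_eqF// fineK ?fin.
- by move=> k; case: eqP => // _; rewrite fine_ge0 ?alpha2_ge0.
- move=> [|N]; first by rewrite big_ord0 addr_ge0 ?fine_ge0.
  rewrite big_ord_recl/= lerD2l.
  rewrite -lee_fin fineK ?ge0_fin_numE//; apply: le_trans (psum N.+1).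
  rewrite big_add1/= big_mkord -sumEFin; apply: lee_sum => k _.
  by rewrite /bump/= add1n fineK// fin.
Qed.

End summable_mixing.

Lemma sqr_ratio_cvg0 (R : realType) (a N : nat -> nat) :
  (forall n, (0 < n)%N -> (0 < a n)%N) ->
    (forall n, (0 < n)%N -> (0 < N n)%N) ->
  (fun n => (a n)%:R : R) =o_\oo (fun n => Num.sqrt (N n)%:R : R) ->
  ((a n).+1%:R ^+ 2 / (N n)%:R : R) @[n --> \oo] --> 0.
Proof.
move=> a0 N0 /eqoP ao; apply/cvgrPdist_le => e e0.
(* As [a n >= 1], [(a n + 1)^2 <= 4 (a n)^2]; hence the division by 4. *)
have se : 0 < Num.sqrt (e / 4) by rewrite sqrtr_gt0 divr_gt0.
near=> n.
have n0 : (0 < n)%N by near: n; exact: nbhs_infty_gt.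
have NR : 0 < (N n)%:R :> R by rewrite ltr0n N0.
rewrite sub0r normrN ger0_norm ?divr_ge0 ?exprn_ge0// ler_pdivrMr//.
have : `|(a n)%:R| <= Num.sqrt (e / 4) * `|Num.sqrt (N n)%:R| by near: n;
  exact: ao.
rewrite ger0_norm// ger0_norm ?sqrtr_ge0// => h.
have : (a n)%:R ^+ 2 <= (e / 4) * (N n)%:R.
  rewrite -(@sqr_sqrtr _ (e / 4)) ?divr_ge0 ?(ltW e0)// -(@sqr_sqrtr _ (N n)%:R)
    ?ler0n//.
  by rewrite -exprMn ler_sqr ?nnegrE ?mulr_ge0 ?sqrtr_ge0.
have : (a n).+1%:R <= 2 * (a n)%:R :> R.
  by rewrite -natrM ler_nat mul2n -addnn -addn1 leq_add2l a0.
have : 0 <= (a n).+1%:R :> R by [].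
move: ((a n).+1%:R : R) ((a n)%:R : R) => x y ? ? ?; nra.
Unshelve. all: by end_near. Qed.

Lemma Lnorm2E d (T : measurableType d) (R : realType) (P : probability T R)
  (f : T -> R) :
  bmeas f -> ('N[P]_2%:E[EFin \o f] =
    (Num.sqrt (Rintegral P setT (fun w => f w ^+ 2)))%:E)%E.
Proof.
move=> bf; rewrite unlock /=.
have -> : (\int[P]_x (`|(f x)%:E| `^ 2) =
  (Rintegral P setT (fun w => f w ^+ 2))%:E)%E.
  rewrite -EFin_exp; last exact: bmeasX.
  apply: eq_integral => x _; rewrite /= powR_mulrn//.
  by rewrite real_normK// num_real.
rewrite poweR_EFin powR12_sqrt//; apply: exp_ge0 => w; exact: sqr_ge0.
Qed.

Section one_side.
Context d (T : measurableType d) (R : realType) (P : probability T R).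
Local Notation E f := (Rintegral P setT f).
Variables X Y : int -> {RV P >-> R}.
Hypotheses (statX : strictly_stationary X) (statY : strictly_stationary Y).
Hypothesis indXY : independent_processes X Y.
Hypothesis sumX : (\sum_(1 <= k <oo) alpha2 X k < +oo)%E.
Hypothesis sumY : (\sum_(1 <= k <oo) alpha2 Y k < +oo)%E.
Variables (q : R -> R -> R) (h : R -> R).
Hypothesis qm : forall t, mono01 (q t).
Hypothesis mq : measurable_fun setT (fun z : R * R => q z.1 z.2).
Hypothesis hE : forall t, h t = E (fun w => q t (Y 0 w)).
Hypothesis hm : mono01 h.

Lemma cvg_cov_lag : cvgn
  (fun n => \sum_(1 <= k < n) cov_lag P (fun i => h \o X i) k).
Proof.
have [al [A [alX al0 al_ge0 al_sum]]] := summable_alpha2 sumX.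
rewrite (_ : (fun n => _) = fun n => \sum_(1 <= k < n) lag_cov X h k).
  exact: (cvg_lag_cov statX alX al0 al_ge0 al_sum hm).
by apply/funext => n; apply: eq_bigr => k _; exact: cov_lagE.
Qed.

(** [N] is the size of the sample being autocorrelated and [M] that of the sample defining the
    kernel average. Smallness against [M] is asked only after multiplication by [u n ^+ 2], as
    [a^2 / M] alone may diverge; for the terms in [N] the convergence of [u] suffices. *)
Lemma emp_plug_cvg (N M a : nat -> nat) (u : nat -> R) (l : R) :
  (forall n, (0 < n)%N -> (0 < N n)%N) ->
    (forall n, (0 < n)%N -> (0 < M n)%N) ->
  a n @[n --> \oo] --> \oo ->
  ((a n).+1%:R ^+ 2 / (N n)%:R : R) @[n --> \oo] --> 0 ->
  (u n ^+ 2 * ((a n).+1%:R ^+ 2 / (M n)%:R) : R) @[n --> \oo] --> 0 ->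
  u n @[n --> \oo] --> l ->
  u n ^+ 2 * E (fun w => (emp_plug X Y q (N n) (M n) (a n) w -
    long_run_var P (fun i => h \o X i)) ^+ 2) @[n --> \oo] --> 0.
Proof.
move=> N0 M0 aoo sN sM ul.
have [al [A [alX al0 al_ge0 al_sum]]] := summable_alpha2 sumX.
have [be [B [beY be0 be_ge0 be_sum]]] := summable_alpha2 sumY.
set V := long_run_var _ _.
have A0 : 0 <= A by have := al_sum 0; rewrite big_ord0.
pose r n := \sum_(1 <= k < n) lag_cov X h k.
have cr : r n @[n --> \oo] --> limn r.
  exact: (cvg_lag_cov statX alX al0 al_ge0 al_sum hm).
pose dl n := `|r (a n).+1 - limn r|.
have dl0 : dl n @[n --> \oo] --> 0.
  rewrite -[0](normr0 R) -(subrr (limn r)); apply: cvg_norm; apply: cvgB;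
    last exact: cvg_cst.
  apply: (cvg_comp (fun n => (a n).+1) r) cr.
  have := cvg_comp a S aoo; apply.
  by move=> D [k _ kD]; exists k => // j /= kj; apply: kD; exact: leqW.
pose s n : R := (a n).+1%:R ^+ 2 / (N n)%:R.
pose s' n : R := u n ^+ 2 * ((a n).+1%:R ^+ 2 / (M n)%:R).
pose bd n := 3 *
  (128 * (4 * B * s' n + u n ^+ 2 * (A * s n)) + u n ^+ 2 * (64 * A * s n) +
   u n ^+ 2 * (4 * A * s n + 2 * dl n) ^+ 2).
have bd0 : bd n @[n --> \oo] --> 0.
  have u2 : u n ^+ 2 @[n --> \oo] --> l ^+ 2 by exact: (cvgM ul ul).
  have cM (k : R) (f : nat -> R) : f n @[n --> \oo] --> 0 ->
    k * f n @[n --> \oo] --> 0.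
    by move=> f0; rewrite -[0](mulr0 k); exact: cvgMr.
  have cD (f g : nat -> R) : f n @[n --> \oo] --> 0 -> g n @[n --> \oo] --> 0 ->
    f n + g n @[n --> \oo] --> 0.
    by move=> f0 g0; rewrite -[0](addr0 0); exact: cvgD.
  have cU (f : nat -> R) : f n @[n --> \oo] --> 0 ->
    u n ^+ 2 * f n @[n --> \oo] --> 0.
    by move=> f0; rewrite -[0](mulr0 (l ^+ 2)); exact: cvgM.
  apply: (cM 3); apply: (cD _ _); first apply: (cD _ _).
  - by apply: (cM 128); apply: (cD _ _); [exact: cM|apply: (cU _); exact: cM].
  - by apply: (cU _); exact: cM.
  - apply: (cU _); have z : 4 * A * s n + 2 * dl n @[n --> \oo] --> 0.
      by apply: (cD _ _); exact: cM.
    by have := cvgM z z; rewrite mulr0; exact.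
apply: (@squeeze_cvgr _ _ _ _ (fun=> 0) bd); [|exact: cvg_cst|exact: bd0].
near=> n.
have n0 : (0 < n)%N by near: n; exact: nbhs_infty_gt.
have N0R : 0 < (N n)%:R :> R by rewrite ltr0n N0.
have M0R : 0 < (M n)%:R :> R by rewrite ltr0n M0.
have u20 : 0 <= u n ^+ 2 by exact: sqr_ge0.
rewrite mulr_ge0//=; last by apply: exp_ge0 => w; exact: sqr_ge0.
have mse := emp_plug_lrv_mse statX statY indXY alX al0 al_ge0 al_sum beY be0
  be_ge0 be_sum qm mq hE hm (a n) (N0 n n0) (M0 n n0).
apply: (le_trans (ler_wpM2l u20 mse)).
have -> : bd n =
  u n ^+ 2 * (3 * (128 * (a n).+1%:R ^+ 2 * (4 * B / (M n)%:R + A / (N n)%:R) +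
   64 * A * (a n).+1%:R ^+ 2 / (N n)%:R + (4 * A * s n + 2 * dl n) ^+ 2)).
  by rewrite /bd /s' /s; ring.
rewrite ler_wpM2l// ler_pM2l// lerD2l ler_sqr ?nnegrE.
(* The bias term [a / N] is enlarged to [s n], using [a <= (a + 1)^2]. *)
- rewrite lerD2r -!mulrA ler_pM2l// ler_wpM2l// ler_pM2r ?invr_gt0//.
  by rewrite -natrX ler_nat; lia.
- by rewrite addr_ge0 ?mulr_ge0 ?invr_ge0 ?(ltW N0R).
- by rewrite addr_ge0 ?mulr_ge0 ?invr_ge0 ?exprn_ge0 ?(ltW N0R) ?normr_ge0.
Unshelve. all: by end_near. Qed.

End one_side.

(** Here [t] is the point of evaluation and [y] an observation of the averaged sample. Monotonicity
    in [y] serves the mixing of that sample, and monotonicity in [t] passes to [H_of]. *)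
Definition lt_kernel {R : realType} (t y : R) : R := (t < y)%R%:R.

Definition gt_kernel {R : realType} (t y : R) : R := (y < t)%R%:R.

(** * The two kernels and their means *)

Section kernels.
Context d (T : measurableType d) (R : realType) (P : probability T R).
Local Notation E f := (Rintegral P setT f).

Lemma mono01_lt_kernel (t : R) : mono01 (lt_kernel t).
Proof.
split=> [|y]; last by rewrite /lt_kernel; case: (_ < _); rewrite lexx ler01.
right=> x y xy; rewrite /lt_kernel ler_nat.
by case: (ltP t x) => // tx; rewrite (lt_le_trans tx xy).
Qed.

Lemma mono01_gt_kernel (t : R) : mono01 (gt_kernel t).
Proof.
split=> [|y]; last by rewrite /gt_kernel; case: (_ < _); rewrite lexx ler01.
left=> x y xy; rewrite /gt_kernel ler_nat.
by case: (ltP y t) => // yt; rewrite (le_lt_trans xy yt).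
Qed.

Lemma measurable_lt_kernel : measurable_fun setT
  (fun z : R * R => lt_kernel z.1 z.2).
Proof. by apply: (bmeas_bool R (measurable_fun_ltr _ _)).1. Qed.

Lemma measurable_gt_kernel : measurable_fun setT
  (fun z : R * R => gt_kernel z.1 z.2).
Proof. by apply: (bmeas_bool R (measurable_fun_ltr _ _)).1. Qed.

Variable X : int -> {RV P >-> R}.
Hypothesis statX : strictly_stationary X.

(** [H_of] is defined at time 1 and the plug-in bounds centre at time 0; stationarity joins the
    two. *)
Lemma H_of_kernel t : H_of X t = E (fun w => lt_kernel t (X 0 w)).
Proof.
rewrite -(stationary_exp1 statX 1 (mono01_bmeas_id (mono01_lt_kernel t))).
rewrite /H_of /ccdf /distribution /pushforward -exp_indic; last first.
  by rewrite -[X in measurable X]setTI; exact: measurable_funPT.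
apply: eq_exp => w; rewrite indicE.
by congr ((nat_of_bool _)%:R); apply/idP/idP; rewrite inE/= in_itv/= andbT.
Qed.

Lemma G_of_kernel t : G_of X t = E (fun w => gt_kernel t (X 0 w)).
Proof.
rewrite -(stationary_exp1 statX 1 (mono01_bmeas_id (mono01_gt_kernel t))).
rewrite /G_of -exp_indic; last first.
  rewrite (_ : [set w | _] = X 1 @^-1` `]-oo, t[); last first.
    by apply/seteqP; split => w /=; rewrite in_itv.
  by rewrite -[X in measurable X]setTI; exact: measurable_funPT.
apply: eq_exp => w; rewrite indicE.
by congr ((nat_of_bool _)%:R); apply/idP/idP; rewrite inE.
Qed.

Lemma exp_kernel01 (q : R -> R -> R) t : mono01 (q t) ->
  0 <= E (fun w => q t (X 0 w)) <= 1.
Proof. exact: (@exp_mono01_itv _ _ _ P X (q t)). Qed.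

Lemma mono01_H_of : mono01 (H_of X).
Proof.
split=> [|t]; last by rewrite H_of_kernel exp_kernel01//;
  exact: mono01_lt_kernel.
left=> s t st; rewrite !H_of_kernel; apply: le_exp => [||w].
- exact: (bmeas_mono01_process X (mono01_lt_kernel _)).
- exact: (bmeas_mono01_process X (mono01_lt_kernel _)).
- rewrite /lt_kernel ler_nat.
  by case: (ltP t (X 0 w)) => // tX; rewrite (le_lt_trans st tX).
Qed.

Lemma mono01_G_of : mono01 (G_of X).
Proof.
split=> [|t]; last by rewrite G_of_kernel exp_kernel01//;
  exact: mono01_gt_kernel.
right=> s t st; rewrite !G_of_kernel; apply: le_exp => [||w].
- exact: (bmeas_mono01_process X (mono01_gt_kernel _)).
- exact: (bmeas_mono01_process X (mono01_gt_kernel _)).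
- rewrite /gt_kernel ler_nat.
  by case: (ltP (X 0 w) s) => // sX; rewrite (lt_le_trans sX st).
Qed.

End kernels.

Lemma independent_processesC d (T : measurableType d) (R : realType)
    (P : probability T R) (X Y : int -> {RV P >-> R}) :
  independent_processes X Y -> independent_processes Y X.
Proof. by move=> XY A B YA XB; rewrite setIC muleC; exact: XY. Qed.

(** The two convergence claims guarantee that the infinite sums inside [V_lim] are genuine
    limits. *)
Theorem proposition2p1 (d : measure_display) (T : measurableType d)
    (R : realType) (P : probability T R) (X Y : int -> {RV P >-> R})
    (m a b : nat -> nat) (c : R)
    (statX : strictly_stationary X) (statY : strictly_stationary Y)
    (indXY : independent_processes X Y)
    (m_gt0 : forall n, (0 < n)%N -> (0 < m n)%N)
    (c_ge0 : 0 <= c)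
    (nm_cvg : (n%:R / (m n)%:R : R) @[n --> \oo] --> c)
    (sumX : (\sum_(1 <= k <oo) alpha2 X k < +oo)%E)
    (sumY : (\sum_(1 <= k <oo) alpha2 Y k < +oo)%E)
    (a_gt0 : forall n, (0 < n)%N -> (0 < a n)%N)
    (b_gt0 : forall n, (0 < n)%N -> (0 < b n)%N)
    (a_oo : a n @[n --> \oo] --> \oo)
    (b_oo : b n @[n --> \oo] --> \oo)
    (a_o : (fun n => (a n)%:R : R) =o_\oo (fun n => Num.sqrt n%:R : R))
    (b_o : (fun n => (b n)%:R : R) =o_\oo (fun n => Num.sqrt (m n)%:R : R)) :
  [/\ cvgn (fun N => \sum_(1 <= k < N) cov_lag P (fun i => H_of Y \o X i) k),
      cvgn (fun N => \sum_(1 <= k < N) cov_lag P (fun i => G_of X \o Y i) k) &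
      'N[P]_2%:E[EFin \o (V_est X Y n (m n) (a n) (b n) \- cst (V_lim X Y c))%R]%E
        @[n --> \oo] --> 0%E].
Proof.
have indYX := independent_processesC indXY.
have Hm := mono01_H_of statY; have Gm := mono01_G_of statX.
have lm := @mono01_lt_kernel R; have gm := @mono01_gt_kernel R.
have lmeas := @measurable_lt_kernel R; have gmeas := @measurable_gt_kernel R.
split; [exact: (cvg_cov_lag statX sumX Hm) | exact: (cvg_cov_lag statY sumY Gm)
  | ].
pose r n : R := n%:R / (m n)%:R.
have sA := @sqr_ratio_cvg0 R a id a_gt0 (fun n n0 => n0) a_o.
have sB := @sqr_ratio_cvg0 R b m b_gt0 m_gt0 b_o.
set L1 := long_run_var P (fun i => H_of Y \o X i).
set L2 := long_run_var P (fun i => G_of X \o Y i).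
pose e1 n := emp_plug X Y lt_kernel n (m n) (a n).
pose e2 n := emp_plug Y X gt_kernel (m n) n (b n).
have b1 n : bmeas (e1 n) by exact: bmeas_emp_plug.
have b2 n : bmeas (e2 n) by exact: bmeas_emp_plug.
have bc (k : R) : bmeas (fun _ : T => k) := bmeas_cst _ k.
pose E f := Rintegral P setT f.
have c1 : E (fun w => (e1 n w - L1) ^+ 2) @[n --> \oo] --> 0.
  (* The ratio over [m n] is the ratio over [n] times [r n], which converges to [c]. *)
  have sM : (1 ^+ 2 * ((a n).+1%:R ^+ 2 / (m n)%:R) : R) @[n --> \oo] --> 0.
    have : ((a n).+1%:R ^+ 2 / n%:R : R) *
      r n @[n --> \oo] --> 0 by rewrite -[0](mul0r c); exact: cvgM.
    apply: cvg_trans; apply: near_eq_cvg; near=> n.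
    have n0 : (0 < n)%N by near: n; exact: nbhs_infty_gt.
    by rewrite /r; field; rewrite !pnatr_eq0 -!lt0n n0 m_gt0.
  have -> : (fun n => E (fun w => (e1 n w - L1) ^+ 2)) =
      (fun n => (1 : R) ^+ 2 * E (fun w => (e1 n w - L1) ^+ 2)).
    by apply/funext => n; rewrite expr1n mul1r.
  exact: (@emp_plug_cvg _ _ _ _ _ _ statX statY indXY sumX sumY _ _ lm lmeas
    (H_of_kernel statY) Hm id m a (fun=> 1) 1 (fun n n0 => n0) m_gt0 a_oo sA sM
      (cvg_cst (1 : R))).
have c2 : r n ^+ 2 * E (fun w => (e2 n w - L2) ^+ 2) @[n --> \oo] --> 0.
  apply: (@emp_plug_cvg _ _ _ _ _ _ statY statX indYX sumY sumX _ _ gm gmeas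
    (G_of_kernel statX) Gm m id b r c m_gt0 (fun n n0 => n0) b_oo sB _ nm_cvg).
  (* One factor of [r n ^+ 2] is spent on changing the denominator from [n] to [m n]; the other
     stays bounded. *)
  have : ((b n).+1%:R ^+ 2 / (m n)%:R : R) *
    r n @[n --> \oo] --> 0 by rewrite -[0](mul0r c); exact: cvgM.
  apply: cvg_trans; apply: near_eq_cvg; near=> n.
  have n0 : (0 < n)%N by near: n; exact: nbhs_infty_gt.
  by rewrite /r; field; rewrite !pnatr_eq0 -!lt0n n0 m_gt0.
pose f n w := V_est X Y n (m n) (a n) (b n) w - V_lim X Y c.
(* [H_emp] and [G_emp] unfold to [plug] with the two kernels, so both halves of [V_est] are
   convertible to [e1] and [e2]. The last term is deterministic. *)
have fE n w : f n w = (e1 n w - L1) + r n * (e2 n w - L2) + (r n - c) * L2.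
  rewrite /f /V_est /V_lim -/L1 -/L2 -[emp_long_run_var n _ _]/(e1 n w)
    -[emp_long_run_var (m n) _ _]/(e2 n w) /r.
  by ring.
have bf n : bmeas (f n).
  apply: bmeasB => //; apply: bmeasD; first exact: b1.
  by apply: bmeasM => //; exact: b2.
have bq1 n : bmeas (fun w => (e1 n w - L1) ^+ 2) by apply: bmeasX;
  exact: bmeasB.
have bq2 n : bmeas (fun w => (e2 n w - L2) ^+ 2) by apply: bmeasX;
  exact: bmeasB.
pose bd n := 3 *
  (E (fun w => (e1 n w - L1) ^+ 2) + r n ^+ 2 *
  E (fun w => (e2 n w - L2) ^+ 2) +
   ((r n - c) * L2) ^+ 2).
have bd0 : bd n @[n --> \oo] --> 0.
  rewrite -[0](mulr0 3); apply: cvgMr.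
  rewrite -[0](addr0 0); apply: cvgD; first by rewrite -[0](addr0 0);
    exact: cvgD.
  have rc : (r n - c) * L2 @[n --> \oo] --> 0.
    by rewrite -[0](mul0r L2) -(subrr c); apply: cvgM;
      [apply: cvgB => //; exact: cvg_cst|exact: cvg_cst].
  by have := cvgM rc rc; rewrite mulr0; exact.
have Ef0 : E (fun w => f n w ^+ 2) @[n --> \oo] --> 0.
  apply: (@squeeze_cvgr _ _ _ _ (fun=> 0) bd); [|exact: cvg_cst|exact: bd0].
  near=> n; rewrite exp_ge0/=; last by move=> w; exact: sqr_ge0.
  have -> : bd n = E (fun w => 3 *
    ((e1 n w - L1) ^+ 2 + r n ^+ 2 * (e2 n w - L2) ^+ 2 +
    ((r n - c) * L2) ^+ 2)).
    rewrite /E expZl; last by apply: bmeasD => //; apply: bmeasD => //;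
      exact: bmeasM.
    rewrite expD//; last by apply: bmeasD => //; exact: bmeasM.
    by rewrite exp_cst expD ?expZl//; exact: bmeasM.
  apply: le_exp => [||w]; first exact: bmeasX.
    by apply: bmeasM => //; apply: bmeasD => //; apply: bmeasD => //;
      exact: bmeasM.
  rewrite fE -exprMn; move: (e1 n w - L1) (r n * _) (_ * L2) => x y z.
  have := sqr_ge0 (x - y); have := sqr_ge0 (x - z); have := sqr_ge0 (y - z);
    nra.
rewrite (_ : (fun n => _) = fun n => (Num.sqrt (E (fun w => f n w ^+ 2)))%:E);
  last first.
  by apply/funext => n; rewrite -Lnorm2E.
apply: cvg_EFin; first exact: nearW.
rewrite -[0](@sqrtr0 R).
exact: (continuous_cvg _ (@sqrt_continuous R 0) Ef0).
Unshelve. all: by end_near. Qed.
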